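(* Let $y\in M$ be such that $({\rm A}_y^+)$ holds with the fundamental solution $\Gamma=\Gamma_y$ in $T_y$. Let $\Omega\subset T_y$, $y\notin\partial\Omega$, be a strongly admissible domain (with $y$), let $\alpha\in\mathbb{R}$, $\beta>\alpha>\frac{8-\beta}{3}$, $\beta>2$ and $R\ge e\,\sup_{\Omega}\Gamma^{\frac{1}{2-\beta}}$. Let $u\in C^2(\Omega)\cap C^1(\overline{\Omega})$, and set $$\mathcal{C}(u):=\frac{\alpha-2}{2-\beta}\int_{\partial\Omega}u^2\,\Gamma^{\frac{\alpha-2}{2-\beta}-1}\langle\widetilde{\nabla}\Gamma,d\nu\rangle-2\int_{\partial\Omega}\Gamma^{\frac{\alpha-2}{2-\beta}}u\langle\widetilde{\nabla}u,d\nu\rangle .$$ Then $$\int_{\Omega}\frac{\Gamma^{\frac{\alpha}{2-\beta}}}{|\nabla_X\Gamma^{\frac{1}{2-\beta}}|^2}|\mathcal{L}u|^2\,d\nu\ge\frac{(\beta-\alpha)^2}{4}\int_{\Omega}\Gamma^{\frac{\alpha-2}{2-\beta}}|\nabla_Xu|^2\,d\nu$$ $$+\frac{(\beta+3\alpha-8)(\beta+\alpha-4)(\beta-\alpha)}{8(\beta-2)}\int_{\partial\Omega}\Gamma^{\frac{\alpha-2}{2-\beta}-1}|u|^2\langle\widetilde{\nabla}\Gamma,d\nu\rangle+\frac{(\beta+\alpha-4)(\beta-\alpha)}{4}\mathcal{C}(u),$$ and also $$\int_{\Omega}\frac{\Gamma^{\frac{\alpha}{2-\beta}}}{|\nabla_X\Gamma^{\frac{1}{2-\beta}}|^2}|\mathcal{L}u|^2\,d\nu\ge\frac{(\beta-\alpha)^2}{4}\int_{\Omega}\Gamma^{\frac{\alpha-2}{2-\beta}}|\nabla_Xu|^2\,d\nu$$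 $$+\frac{(\beta+3\alpha-8)(\beta-\alpha)}{16}\int_{\Omega}\Gamma^{\frac{\alpha-4}{2-\beta}}|\nabla_X\Gamma^{\frac{1}{2-\beta}}|^2\left(\ln\frac{R}{\Gamma^{\frac{1}{2-\beta}}}\right)^{-2}|u|^2\,d\nu$$ $$+\frac{(\beta+3\alpha-8)(\beta-\alpha)}{8(\beta-2)}\int_{\partial\Omega}\Gamma^{\frac{\alpha-2}{2-\beta}-1}\left(\ln\frac{R}{\Gamma^{\frac{1}{2-\beta}}}\right)^{-1}|u|^2\langle\widetilde{\nabla}\Gamma,d\nu\rangle$$ $$+\frac{(\beta+3\alpha-8)(\beta+\alpha-4)(\beta-\alpha)}{8(\beta-2)}\int_{\partial\Omega}\Gamma^{\frac{\alpha-2}{2-\beta}-1}|u|^2\langle\widetilde{\nabla}\Gamma,d\nu\rangle+\frac{(\beta+\alpha-4)(\beta-\alpha)}{4}\mathcal{C}(u).$$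
   Context: Let $M$ be a smooth manifold of dimension $n$ with a volume form $d\nu$, let $\{X_k\}_{k=1}^{N}$, $N\le n$, be a family of real vector fields on $M$, and let $\mathcal{L}=\sum_{k=1}^{N}X_k^2$, $\nabla_X=(X_1,\ldots,X_N)$. The spaces $C^{1}$, $C^{2}$ are the spaces of functions with continuous first (respectively, up to second) derivatives with respect to $\{X_k\}$. $\langle X_k,d\nu\rangle$ denotes the duality product (contraction) of the vector field $X_k$ with the $n$-form $d\nu$; it is an $(n-1)$-form. For a function $u$, $\widetilde{\nabla}u=\sum_{k=1}^{N}(X_ku)X_k$, so that $\langle\widetilde{\nabla}u,d\nu\rangle=\sum_{k=1}^N (X_ku)\langle X_k,d\nu\rangle$. Assumption $({\rm A}_y)$ for a point $y\in M$: there is an open set $T_y\subset M$ containing $y$ such that $-\mathcal{L}$ has a fundamental solution in $T_y$, i.e. there is a function $\Gamma_y\in C^2(T_y\setminus\{y\})$ with $-\mathcal{L}\Gamma_y=\delta_y$ in $T_y$, where $\delta_y$ is the Dirac distribution at $y$. Assumption $({\rm A}_y^+)$: $({\rm A}_y)$ holds and, moreover, $\Gamma_y(x)>0$ in $T_y\setminus\{y\}$ and $\frac{1}{\Gamma_y}(y)=0$. Integrals over $\Omega$ involving $\mathcal{L}\Gamma_y$ are interpreted through the identity $-\mathcal{L}\Gamma_y=\delta_y$. Admissible domain: an open bounded set $\Omega\subset M$ whose boundary $\partial\Omega$ has no self-intersections and such that $$\sum_{k=1}^{N}\int_{\Omega}X_kf_k\,d\nu=\sum_{k=1}^{N}\int_{\partial\Omega}f_k\langle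 X_k,d\nu\rangle\qquad( * )$$ for all $f_k\in C^1(\Omega)\cap C(\overline{\Omega})$, $k=1,\ldots,N$. An admissible domain $\Omega$ is strongly admissible with $y\in M$ if $({\rm A}_y)$ is satisfied, $\Omega\subset T_y$, and $( * )$ holds for $f_k=vX_k\Gamma_y$ for all $v\in C^1(\Omega)\cap C(\overline{\Omega})$. *)

(* Defs.v *)
From HB Require Import structures.
From mathcomp Require Import all_boot all_order all_algebra.
From mathcomp Require Import all_classical all_reals all_analysis.

Set Implicit Arguments.
Unset Strict Implicit.
Unset Printing Implicit Defensive.

Import Order.TTheory GRing.Theory Num.Theory.
Import numFieldNormedType.Exports.

Local Open Scope classical_set_scope.
Local Open Scope ring_scope.

Section lebesgue_tuple.
Context {R : realType}.
Local Notation B := (measurableTypeR R).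

Definition tcons n (p : B * n.-tuple B) : n.+1.-tuple B :=
  [the n.+1.-tuple B of p.1 :: p.2].

Lemma measurable_tcons n : measurable_fun [set: B * n.-tuple B] (@tcons n).
Proof. exact: measurable_cons. Qed.

Section step.
Variables (n : nat) (l : {sigma_finite_measure set (n.-tuple B) -> \bar R}).

Definition lebesgue_step : set (n.+1.-tuple B) -> \bar R :=
  pushforward (lebesgue_measure \x l)%E (@tcons n).

Let pushforward_measure : {measure set (n.+1.-tuple B) -> \bar R} :=
  measure_function_pushforward__canonical__measure_function_Measure
    (lebesgue_measure \x l)%E (@measurable_tcons n).

Let step0 : lebesgue_step set0 = 0%E.
Proof. exact: (measure0 pushforward_measure). Qed.

Let step_ge0 A : (0 <= lebesgue_step A)%E.
Proof. exact: (measure_ge0 pushforward_measure). Qed.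

Let step_sigma_additive : semi_sigma_additive lebesgue_step.
Proof. exact: (@measure_semi_sigma_additive _ _ _ pushforward_measure). Qed.

HB.instance Definition _ := isMeasure.Build _ _ _
  lebesgue_step step0 step_ge0 step_sigma_additive.

Let sigma_finite_step : sigma_finite setT lebesgue_step.
Proof.
have /sigma_finiteP[F [FT ndF Foo]] :=
  sigma_finiteT (@lebesgue_measure R : {sigma_finite_measure set B -> \bar R}).
have /sigma_finiteP[G [GT ndG Goo]] := sigma_finiteT l.
pose split (t : n.+1.-tuple B) : B * n.-tuple B :=
  (thead t, [tuple of behead t]).
have splitK t : tcons (split t) = t by rewrite [RHS]tuple_eta; exact: val_inj.
have tconsK p : split (tcons p) = p.
  by case: p => a t; congr pair; exact: val_inj.
have msplit : measurable_fun setT split.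
  apply/measurable_fun_pairP; split.
    exact: measurable_tnth.
  exact: measurable_behead.
exists (fun i => split @^-1` (F i `*` G i)).
  rewrite -preimage_bigcup [X in _ @^-1` X](_ : _ = setT) ?preimage_setT//.
  rewrite -setXTT FT GT predeqE => -[x y]; split.
    by move=> [k _ []/= ? ?]; split; exists k.
  move=> [/= [k _ Fkx] [h _ Ghy]]; exists (maxn k h) => //; split => /=.
    by move: x Fkx; exact/subsetPset/ndF/leq_maxl.
  by move: y Ghy; exact/subsetPset/ndG/leq_maxr.
move=> i; have [mF Fi] := Foo i; have [mG Gi] := Goo i; split.
  by rewrite -[X in measurable X]setTI; apply: msplit => //; exact: measurableX.
rewrite /lebesgue_step /pushforward -comp_preimage.
rewrite (_ : _ @^-1` _ = F i `*` G i); last first.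
  apply/funext => p; change ((F i `*` G i) (split (tcons p)) = (F i `*` G i) p).
  by rewrite tconsK.
by rewrite product_measure1E// lte_mul_pinfty// ge0_fin_numE.
Qed.

HB.instance Definition _ :=
  @Measure_isSigmaFinite.Build _ _ _ lebesgue_step sigma_finite_step.

End step.

Fixpoint lebesgue_tuple n : {sigma_finite_measure set (n.-tuple B) -> \bar R} :=
  if n is n'.+1 then lebesgue_step (lebesgue_tuple n') else \d_([tuple]).

End lebesgue_tuple.

Section calculus.
Context {R : realType}.

(* class C^k on an open set [U] of R^n, through iterated partial derivatives *)
Fixpoint Ck (k : nat) n (V : normedModType R) (U : set 'rV[R]_n)
    (f : 'rV[R]_n -> V) : Prop :=
  (forall v, U v -> {for v, continuous f}) /\
  if k is k'.+1 then
    forall i : 'I_n, (forall v, U v -> derivable f v (delta_mx 0 i)) /\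
      Ck k' U (fun v => 'D_(delta_mx 0 i) f v)
  else True.

Definition smooth n (V : normedModType R) (U : set 'rV[R]_n)
  (f : 'rV[R]_n -> V) := forall k, Ck k U f.

Definition rV_of n (t : n.-tuple (measurableTypeR R)) : 'rV[R]_n :=
  \row_i tnth t i.

End calculus.

Record chart (R : realType) (M : ptopologicalType) (n : nat) := Chart {
  cdom : set M ;
  cfun : M -> 'rV[R]_n ;
  cinv : 'rV[R]_n -> M ;
  open_cdom : open cdom ;
  open_cimg : open (cfun @` cdom) ;
  cfunK : forall x, cdom x -> cinv (cfun x) = x ;
  cfun_continuous : forall x, cdom x -> {for x, continuous cfun} ;
  cinv_continuous : forall x, cdom x -> {for cfun x, continuous cinv} }.

Definition cimg (R : realType) (M : ptopologicalType) n (c : chart R M n) :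
  set 'rV[R]_n := cfun c @` cdom c.

Definition transition (R : realType) (M : ptopologicalType) n
  (c c' : chart R M n) : 'rV[R]_n -> 'rV[R]_n := cfun c' \o cinv c.

(* The atlas need not be maximal. [chart_at x] is a chosen chart around [x]; it
   serves to name tangent vectors at [x] by their coordinates. *)
Record manifold (R : realType) (M : ptopologicalType) (n : nat) := Manifold {
  atlas : set (chart R M n) ;
  chart_at : M -> chart R M n ;
  atlas_chart_at : forall x, atlas (chart_at x) ;
  cdom_chart_at : forall x, cdom (chart_at x) x ;
  smooth_transition : forall c c', atlas c -> atlas c' ->
    smooth (cimg c `&` cinv c @^-1` cdom c') (transition c c') ;
  manifold_hausdorff : hausdorff_space M ;
  manifold_second_countable : @second_countable M }.

(* A vector field, by its coordinates [vf c x] at [x] in each chart [c] of the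
   atlas. Coordinates are row vectors and ['J] is the matrix acting on rows. *)
Record vector_field (R : realType) (M : ptopologicalType) n
    (A : manifold R M n) := VectorField {
  vf : chart R M n -> M -> 'rV[R]_n ;
  vf_smooth : forall c, atlas A c -> smooth (cimg c) (vf c \o cinv c) ;
  vf_transition : forall c c' x, atlas A c -> atlas A c' ->
    cdom c x -> cdom c' x ->
    vf c' x = vf c x *m 'J (transition c c') (cfun c x) }.

(* A volume form, [volc c x * dx_1 /\ ... /\ dx_n] at [x] in the chart [c]. *)
Record volume_form (R : realType) (M : ptopologicalType) n
    (A : manifold R M n) := VolumeForm {
  volc : chart R M n -> M -> R ;
  volc_smooth : forall c, atlas A c -> smooth (cimg c) (volc c \o cinv c) ;
  volc_neq0 : forall c x, atlas A c -> cdom c x -> volc c x != 0 ;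
  volc_transition : forall c c' x, atlas A c -> atlas A c' ->
    cdom c x -> cdom c' x ->
    volc c x = volc c' x * \det ('J (transition c c') (cfun c x)) }.

Definition borel (M : ptopologicalType) := g_sigma_algebraType (@open M).

(* [mu] is the measure of integration against the volume form [nu], the
   manifold being oriented by [nu]; this determines [mu] on the Borel sets. *)
Definition is_volume_measure (R : realType) (M : ptopologicalType) n
    (A : manifold R M n) (nu : volume_form A)
    (mu : {measure set (borel M) -> \bar R}) :=
  forall c (S : set (borel M)), atlas A c -> measurable S -> S `<=` cdom c ->
    mu S = (\int[lebesgue_tuple n]_(t in [set t | (cfun c @` S) (rV_of t)])
              `|volc nu c (cinv c (rV_of t))|%:E)%E.

Section derivation.
Context {R : realType} {M : ptopologicalType} {n : nat} {A : manifold R M n}.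

Definition integral_curve (X : vector_field A) (x : M) (g : R -> M) :=
  g 0 = x /\
  exists2 e : R, 0 < e & forall t, `|t| < e ->
    {for t, continuous g} /\
    forall c, atlas A c -> cdom c (g t) ->
      is_derive (t : R) (1 : R) (cfun c \o g) (vf X c (g t)).

(* Integral curves exist and their germs at [0] are unique (Cauchy-Lipschitz),
   so neither the default value nor the choice made by [xget] matters. *)
Definition flow_line (X : vector_field A) (x : M) : R -> M :=
  xget (cst x) (integral_curve X x).

Definition Xderivable (X : vector_field A) (u : M -> R) (x : M) :=
  derivable (u \o flow_line X x) 0 1.

Definition Xd (X : vector_field A) (u : M -> R) (x : M) : R :=
  derive1 (u \o flow_line X x) 0.

Context {N : nat} (X : 'I_N -> vector_field A).

Definition C1 (U : set M) (u : M -> R) :=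
  (forall x, U x -> {for x, continuous u}) /\
  forall k, (forall x, U x -> Xderivable (X k) u x) /\
            (forall x, U x -> {for x, continuous (Xd (X k) u)}).

Definition C2 (U : set M) (u : M -> R) :=
  C1 U u /\ forall k, C1 U (Xd (X k) u).

(* C^1 on the open set [U], the function and its first derivatives extending
   continuously to [K], where U `<=` K `<=` closure U. *)
Definition C1_upto (U K : set M) (u : M -> R) :=
  [/\ C1 U u, {within K, continuous u} &
      forall k, exists2 g : M -> R,
        {within K, continuous g} & forall x, U x -> g x = Xd (X k) u x].

(* The value on [closure U] of the continuous extension of [g]. *)
Definition ext (U : set M) (g : M -> R) (x : M) : R :=
  lim (g y @[y --> within U (nbhs x)]).

Definition sublaplacian (u : M -> R) (x : M) : R :=
  \sum_k Xd (X k) (Xd (X k) u) x.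

Definition sqgrad (u : M -> R) (x : M) : R := \sum_k Xd (X k) u x ^+ 2.

End derivation.

Section fundamental_solution.
Context {R : realType} {M : ptopologicalType} {n : nat} {A : manifold R M n}.
Context {N : nat} (X : 'I_N -> vector_field A) (nu : volume_form A).
Context (mu : {measure set (borel M) -> \bar R}).

Definition divergence (Y : vector_field A) (x : M) : R :=
  let c := chart_at A x in
  (volc nu c x)^-1 * \sum_(i < n)
    'D_(delta_mx 0 i) (fun v => volc nu c (cinv c v) * vf Y c (cinv c v) 0 i)
      (cfun c x).

(* the formal adjoint of [Xd Y] with respect to the volume form *)
Definition Xadj (Y : vector_field A) (phi : M -> R) (x : M) : R :=
  - Xd Y phi x - divergence Y x * phi x.

Definition test_function (T : set M) (phi : M -> R) :=
  (forall c, atlas A c -> smooth (cimg c) (phi \o cinv c)) /\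
  exists K, [/\ compact K, K `<=` T & forall x, ~ K x -> phi x = 0].

Definition locally_integrable (T : set M) (g : M -> R) :=
  forall K : set M, compact K -> K `<=` T -> mu.-integrable K (EFin \o g).

(* [- L g = delta_y] in the sense of distributions on [T] *)
Definition neg_sublaplacian_is_dirac (T : set M) (y : M) (g : M -> R) :=
  locally_integrable T g /\
  forall phi, test_function T phi ->
    - (\int[mu]_(x in T) (g x * \sum_k Xadj (X k) (Xadj (X k) phi) x)) = phi y.

Definition assumption_A (y : M) (T : set M) (G : M -> R) :=
  [/\ open T, T y, C2 X (T `\ y) G & neg_sublaplacian_is_dirac T y G].

Definition assumption_Aplus (y : M) (T : set M) (G : M -> R) :=
  [/\ assumption_A y T G, (forall x, (T `\ y) x -> 0 < G x) &
      (G x)^-1 @[x --> dnbhs y] --> (0 : R)].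

End fundamental_solution.

Section boundary.
Context {R : realType} {M : ptopologicalType} {m : nat}.
Context {A : manifold R M m.+1}.

Definition boundary (S : set M) := closure S `\` interior S.

Definition open_cube : set 'rV[R]_m := [set s | forall i, 0 < s 0 i < 1].
Definition closed_cube : set 'rV[R]_m := [set s | forall i, 0 <= s 0 i <= 1].

(* [S] is a topological hypersurface: it is locally homeomorphic to open sets
   of R^m *)
Definition no_self_intersection (S : set M) :=
  forall x, S x -> exists (U : set M) (f : M -> 'rV[R]_m) (g : 'rV[R]_m -> M),
    [/\ open U /\ U x, open (f @` (S `&` U)), {within S `&` U, continuous f},
        {within f @` (S `&` U), continuous g} &
        forall z, (S `&` U) z -> g (f z) = z].

(* A decomposition of [S] into finitely many C^1 cells, each with a sign, that
   overlap at most along the images of the faces of the cube. The signs are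
   needed for m = 0, where cells are points and cannot be reparametrized. *)
Record cells (S : set M) := Cells {
  ncells : nat ;
  cell_sign : 'I_ncells -> bool ;
  cell : 'I_ncells -> 'rV[R]_m -> M ;
  cell_continuous : forall j, {within closed_cube, continuous (cell j)} ;
  cell_C1 : forall j c, atlas A c ->
    Ck 1 (open_cube `&` cell j @^-1` cdom c) (cfun c \o cell j) ;
  cell_inj : forall i j s t, open_cube s -> open_cube t ->
    cell i s = cell j t -> i = j /\ s = t ;
  cell_cover : \bigcup_j (cell j @` closed_cube) = S }.

(* An m-form on [M]: its value at [x] on m tangent vectors, which are the rows
   of a matrix of coordinates in [chart_at A x]. *)
Definition mform := M -> 'M[R]_(m, m.+1) -> R.

Definition contraction (Y : vector_field A) (nu : volume_form A) : mform :=
  fun x W => let c := chart_at A x in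
    volc nu c x * \det (col_mx (vf Y c x) W : 'M[R]_m.+1).

Definition pullback (w : mform) (s : 'rV[R]_m -> M) (p : 'rV[R]_m) : R :=
  w (s p) ('J (cfun (chart_at A (s p)) \o s) p).

Definition in_cube := [set t : m.-tuple (measurableTypeR R) | open_cube (rV_of t)].

Definition integrable_form (S : set M) (B : cells S) (w : mform) :=
  forall j : 'I_(ncells B), (lebesgue_tuple m).-integrable in_cube
    (fun t => (pullback w (cell j) (rV_of t))%:E).

Definition int_form (S : set M) (B : cells S) (w : mform) : R :=
  \sum_(j < ncells B) (-1) ^+ cell_sign j *
    \int[lebesgue_tuple m]_(t in in_cube) pullback w (cell j) (rV_of t).

Definition scale_form (a : M -> R) (w : mform) : mform :=
  fun x W => a x * w x W.

Context {N : nat} (X : 'I_N -> vector_field A) (nu : volume_form A).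
Context (mu : {measure set (borel M) -> \bar R}).

(* \sum_k f_k <X_k, d nu> *)
Definition flux_form (f : 'I_N -> M -> R) : mform :=
  fun x W => \sum_k f k x * contraction (X k) nu x W.

(* the boundary values of <~nabla u, d nu>, seen from inside [Om] *)
Definition grad_form (Om : set M) (u : M -> R) : mform :=
  flux_form (fun k => ext Om (Xd (X k) u)).

(* For f_k in C^1(Om) and continuous on [closure Om] the left-hand side of the
   divergence formula may fail to converge, even on a ball; the formula is
   required whenever it does. The orientation of the boundary is not imposed on
   [B] beforehand: it is prescribed by the divergence formula. *)
Definition admissible (Om : set M) (B : cells (boundary Om)) :=
  [/\ open Om, compact (closure Om), no_self_intersection (boundary Om),
      forall k, integrable_form B (contraction (X k) nu) &
      forall f : 'I_N -> M -> R,
        (forall k, C1 X Om (f k) /\ {within closure Om, continuous (f k)}) ->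
        mu.-integrable Om (fun x => (\sum_k Xd (X k) (f k) x)%:E) ->
        \int[mu]_(x in Om) (\sum_k Xd (X k) (f k) x) =
        int_form B (flux_form f)].

(* The divergence formula for f_k = v * X_k G. Its left-hand side is
   \int_Om (\sum_k X_k v * X_k G) + \int_Om v * L G, and L G = - delta_y.
   The boundary terms presuppose that [G], which is only given on [T], is
   positive and C^1 up to the boundary of [Om]; this is automatic if
   closure Om `<=` T. *)
Definition strongly_admissible (y : M) (T : set M) (G : M -> R)
    (Om : set M) (B : cells (boundary Om)) :=
  [/\ admissible B /\ assumption_A X nu mu y T G, Om `<=` T,
      C1_upto X (Om `\ y) (closure Om `\ y) G,
      forall x, (boundary Om `\ y) x -> 0 < G x &
      forall v : M -> R, C1 X Om v -> {within closure Om, continuous v} ->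
        mu.-integrable Om (fun x => (\sum_k Xd (X k) v x * Xd (X k) G x)%:E) ->
        \int[mu]_(x in Om) (\sum_k Xd (X k) v x * Xd (X k) G x)
          - v y * \1_Om y =
        int_form B (scale_form v (grad_form Om G))].

End boundary.

(* Main.v *)
Require Import Defs.
From HB Require Import structures.
From mathcomp Require Import all_boot all_order all_algebra.
From mathcomp Require Import all_classical all_reals all_analysis.
From mathcomp Require Import measurable_realfun.
From mathcomp Require Import ring lra.

Set Implicit Arguments.
Unset Strict Implicit.
Unset Printing Implicit Defensive.

Import Order.TTheory GRing.Theory Num.Theory.
Import numFieldNormedType.Exports.

Local Open Scope classical_set_scope.
Local Open Scope ring_scope.

(* Write [G] for the fundamental solution, [gam = beta - 2], [lam = (beta + alpha - 4) / 2],
   [del = beta - alpha], [w = G^p = d^(alpha - 2)] and [ell = (ln (R0 / d))^-1]. Pointwise away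
   from the pole, for [ell] as above or [ell = 0],
     w G^2 gam^2 (L u)^2 / |dG|^2 >= the integrand of the right-hand side
       + div (c1 u^2 G^(p-1) dG + c2 u^2 G^(p-1) ell dG + c3 w u du),
   since the difference is the sum of a square coming from Young's inequality applied to
   [w u (L u)] and of a multiple of [w |du - u (lam + ell / 2) / gam * dG / G|^2]. It remains to
   integrate, i.e. to apply the divergence formula to fields that are singular at [y]: they are
   multiplied by a cutoff [chi (G / n)], which vanishes near [y], and [n] goes to infinity by
   dominated convergence. The only a priori bounds needed are the integrability of
   [G^(q-1) |dG|^2] for [q < 0] and of [G^q] for [q < 1], and, for [w u (L u)], the finiteness of
   the left-hand side. The value [G y] is arbitrary, so everything happens on [Om `\ y], [y] being
   negligible. *)

(** * A cutoff function *)

Section cutoff.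
Context {R : realType}.
Implicit Types s t : R.

(** The cutoff is a function of [G] itself because then its gradient has the right size: with
    [s = G / n], the derivative of [chi (G / n)] along [X k] is [s chi'(s) / G] times that of [G],
    and [s chi'(s)] is bounded. The errors are thus dominated by integrands that already occur in
    the inequality. The cut fields vanish at [y], so the Dirac mass contributes nothing. Both
    inequalities come from one computation, because [ell] enters only as a solution, with values in
    [[0, 1]], of the Riccati equation [ell' = - ell^2 / (gam G)] in the variable [G]. The zero
    solution gives the first one, [(ln (R0 / d))^-1] the second, and [R0 >= e sup d] is what keeps
    the latter below 1. The lower bound on [alpha] says that [4 lam - del > 0], which is the sign
    needed to discard the last square. Together with [beta > 2] it also forces [lam > 0], hence
    [p = 1 - 2 lam / gam < 1], on which the integrability of the right-hand side rests. The term
    [w u (L u)] is apart, since the second derivatives of [u] are not controlled up to the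
    boundary. *)

Definition pos_sqr t : R := Num.max t 0 ^+ 2.

Lemma is_derive_pos_sqr t : is_derive t 1 pos_sqr (2 * Num.max t 0).
Proof.
have [t0|t0|->] := ltgtP t 0.
- rewrite mulr0.
  apply: (@near_eq_is_derive _ _ _ (cst 0)).
  near=> z; rewrite /pos_sqr max_r ?expr0n//; near: z.
  by apply: filterS (lt_nbhsl t0) => z /ltW.
- apply: (@near_eq_is_derive _ _ _ (fun x : R => x ^+ 2)); last first.
    by apply: is_derive_eq; rewrite /GRing.scale/=; ring.
  near=> z; rewrite /pos_sqr max_l//; near: z.
  by apply: filterS (lt_nbhsr t0) => z /ltW.
- rewrite mulr0.
  (* At 0 the difference quotient is either 0 or [h]. *)
  have cv0 : h^-1 *: ((pos_sqr \o shift 0) (h *: 1) - pos_sqr 0) @[h --> 0^'] --> (0 : R).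
    apply/cvgr0Pnorm_lt => e e0; near=> h.
    have h0 : h != 0 by near: h; exact: nbhs_dnbhs_neq.
    rewrite /pos_sqr/= maxxx expr0n subr0 addr0 /GRing.scale/= mulr1.
    apply: (@le_lt_trans _ _ `|h|); last first.
      by near: h; apply: dnbhs0_lt.
    have [hp|hn] := leP h 0; first by rewrite expr0n mulr0 normr0.
    by rewrite expr2 mulrA mulVf// mul1r.
  split; first by apply/cvg_ex; exists 0.
  exact/cvg_lim.
Unshelve. all: by end_near. Qed.

Lemma pos_sqr_eq0 t : t <= 0 -> pos_sqr t = 0.
Proof. by move=> t0; rewrite /pos_sqr max_r// expr0n. Qed.

Lemma pos_sqr_ge0 t : 0 <= pos_sqr t. Proof. exact: sqr_ge0. Qed.

(** A C^1 profile, equal to 1 up to 1 and to 0 from 2 on. The divergence formulas ask for one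
    continuous derivative of a test function, and squared positive parts provide it with an explicit
    formula. *)
Definition cutoff s : R := pos_sqr (1 - pos_sqr (s - 1)).

Definition dcutoff s : R :=
  - (4 * Num.max (1 - pos_sqr (s - 1)) 0 * Num.max (s - 1) 0).

Lemma is_derive_cutoff s : is_derive s 1 cutoff (dcutoff s).
Proof.
have d1 : is_derive s 1 (fun x : R => x - 1) 1.
  by apply: is_derive_eq; rewrite subr0.
have d2 : is_derive s 1 (pos_sqr \o (fun x : R => x - 1)) (2 * Num.max (s - 1) 0).
  apply: (is_derive_eq (is_derive1_comp (g := fun x : R => x - 1) (is_derive_pos_sqr _) d1)).
  by rewrite mulr1.
have d3 : is_derive s 1 (fun x : R => 1 - (pos_sqr \o (fun x : R => x - 1)) x)
    (- (2 * Num.max (s - 1) 0)).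
  apply: (is_derive_eq (is_deriveB (is_derive_cst (1 : R) s 1) d2)).
  by rewrite sub0r.
apply: (is_derive_eq (is_derive1_comp
  (g := fun x : R => 1 - (pos_sqr \o (fun x : R => x - 1)) x) (is_derive_pos_sqr _) d3)).
by rewrite /dcutoff/=; ring.
Qed.

Lemma continuous_dcutoff : continuous dcutoff.
Proof.
have cpos : continuous pos_sqr.
  by move=> t; apply/differentiable_continuous/derivable1_diffP; have [] := is_derive_pos_sqr t.
have cp1 : continuous (fun s : R => pos_sqr (s - 1)).
  move=> s; apply: (@continuous_comp _ _ _ (fun x : R => x - 1) pos_sqr) => //.
    by apply: cvgB => //; exact: cvg_cst.
  exact: cpos.
move=> s; apply: cvgN; apply: cvgM; first apply: cvgM; first exact: cvg_cst.
- apply: (@continuous_max _ _ (fun s => 1 - pos_sqr (s - 1)) (cst 0)).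
  + by apply: cvgB; [exact: cvg_cst|exact: cp1].
  + exact: cvg_cst.
- apply: (@continuous_max _ _ (fun s => s - 1) (cst 0)).
  + by apply: cvgB => //; exact: cvg_cst.
  + exact: cvg_cst.
Qed.

Lemma cutoff_eq1 s : s <= 1 -> cutoff s = 1.
Proof.
by move=> s1; rewrite /cutoff (pos_sqr_eq0 (t := s - 1)) ?subr_le0// subr0 /pos_sqr max_l// expr1n.
Qed.

Lemma pos_sqr_ge1 s : 2 <= s -> 1 <= pos_sqr (s - 1).
Proof. by move=> s2; rewrite /pos_sqr max_l; nra. Qed.

Lemma cutoff_eq0 s : 2 <= s -> cutoff s = 0.
Proof. by move=> s2; rewrite /cutoff pos_sqr_eq0// subr_le0 pos_sqr_ge1. Qed.

Lemma cutoff_ge0 s : 0 <= cutoff s. Proof. exact: pos_sqr_ge0. Qed.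

Lemma cutoff_le1 s : cutoff s <= 1.
Proof.
rewrite /cutoff [X in X <= _]/pos_sqr expr_le1 ?le_max ?lexx ?orbT//.
by rewrite ge_max ler01 lerBlDr lerDl pos_sqr_ge0.
Qed.

Lemma dcutoff_le0 s : dcutoff s <= 0.
Proof. by rewrite oppr_le0 !mulr_ge0// le_max lexx orbT. Qed.

Lemma dcutoff_eq0 s : s <= 1 \/ 2 <= s -> dcutoff s = 0.
Proof.
rewrite /dcutoff => -[s1|s2]; first by rewrite (max_r (_ : s - 1 <= 0)) ?mulr0 ?oppr0// subr_le0.
by rewrite (max_r (_ : 1 - _ <= 0)) ?mulr0 ?mul0r ?oppr0// subr_le0 pos_sqr_ge1.
Qed.

(** The derivative lives on [1 < s < 2], where it is at most [4 * 1 * 1] in absolute value; hence 8.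
    The factor [s] makes the resulting bound [8 |dG| / G] on the gradient of [cutoff (G / n)]
    uniform in [n]. *)
Lemma norm_mul_dcutoff s : `|s * dcutoff s| <= 8.
Proof.
have [s1|s1] := leP s 1; first by rewrite dcutoff_eq0 ?mulr0 ?normr0//; left.
have [s2|s2] := leP 2 s; first by rewrite dcutoff_eq0 ?mulr0 ?normr0//; right.
rewrite normrM (gtr0_norm (_ : 0 < s)); last by lra.
rewrite ler0_norm ?dcutoff_le0// opprK.
have a0 := pos_sqr_ge0 (s - 1).
have : Num.max (1 - pos_sqr (s - 1)) 0 <= 1 by rewrite ge_max; apply/andP; split; lra.
have : 0 <= Num.max (1 - pos_sqr (s - 1)) 0 by rewrite le_max lexx orbT.
rewrite (max_l (_ : 0 <= s - 1)); last by lra.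
set a := Num.max _ _ => ? ?.
have := @ler_pM _ (s * (s - 1)) 2 a 1; nra.
Qed.

Lemma continuous_cutoff : continuous cutoff.
Proof.
move=> s; apply/differentiable_continuous/derivable1_diffP.
by have [] := is_derive_cutoff s.
Qed.

Lemma is_derive_cutoff_scale (c s : R) :
  is_derive s 1 (fun t => cutoff (t / c)) (dcutoff (s / c) / c).
Proof.
have d1 : is_derive s 1 (fun t : R => t / c) c^-1.
  by apply: is_derive_eq; rewrite /GRing.scale/= mulr1 ?mulr0 ?addr0 ?add0r.
exact: (is_derive1_comp (g := fun t : R => t / c) (is_derive_cutoff (s / c)) d1).
Qed.

Lemma continuous_cutoff_scale (c : R) : continuous (fun t => cutoff (t / c)).
Proof.
move=> s; apply/differentiable_continuous/derivable1_diffP.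
by have [] := is_derive_cutoff_scale c s.
Qed.

End cutoff.

(** * Derivatives along flow lines *)

Section flow_derivative.
Context {R : realType} {M : ptopologicalType} {n : nat} {A : manifold R M n}.
Implicit Types (X : vector_field A) (u v : M -> R) (x : M) (U : set M).

Definition is_Xd X u x (a : R) := is_derive (0 : R) 1 (u \o flow_line X x) a.

(** Both branches of [xget] start at [x]: an integral curve by definition, the default because it is
    constant. *)
Lemma flow_line0 X x : flow_line X x 0 = x.
Proof. by rewrite /flow_line; case: xgetP => [g _ []|]. Qed.

Lemma flow_line_continuous0 X x : {for 0, continuous (flow_line X x)}.
Proof.
rewrite /flow_line; case: xgetP => [g _ [_ [e e0 ge]]|_]; last exact: cst_continuous.
by have [] := ge 0; rewrite ?normr0.
Qed.

(** Continuity of the flow line at 0 is what makes derivatives along it local. *)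
Lemma near_flow_line X x (P : set M) :
  nbhs x P -> \forall t \near (0 : R), P (flow_line X x t).
Proof. by move=> xP; apply: flow_line_continuous0; rewrite flow_line0. Qed.

Lemma XdP X u x : Xderivable X u x -> is_Xd X u x (Xd X u x).
Proof. by move=> h; split => //; rewrite /Xd derive1E. Qed.

Lemma is_Xd_derivable X u x a : is_Xd X u x a -> Xderivable X u x.
Proof. by case. Qed.

Lemma is_Xd_val X u x a : is_Xd X u x a -> Xd X u x = a.
Proof. by move=> [_ <-]; rewrite /Xd derive1E. Qed.

Lemma near_eq_is_Xd X u v x a :
  (\near x, u x = v x) -> is_Xd X u x a -> is_Xd X v x a.
Proof. by move=> uv; apply: near_eq_is_derive; exact: (near_flow_line X uv). Qed.

Lemma is_Xd_cst X x (c : R) : is_Xd X (cst c) x 0.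
Proof. exact: is_derive_cst. Qed.

Lemma is_XdM X u v x a b : is_Xd X u x a -> is_Xd X v x b ->
  is_Xd X (fun z => u z * v z) x (u x * b + v x * a).
Proof.
move=> ha hb; apply: (is_derive_eq (is_deriveM ha hb)).
by rewrite /= flow_line0.
Qed.

Lemma is_Xd_comp X u x a (phi : R -> R) (b : R) :
  is_Xd X u x a -> is_derive (u x) 1 phi b -> is_Xd X (phi \o u) x (b * a).
Proof.
move=> ha hb; have hb' : is_derive ((u \o flow_line X x) 0) 1 phi b.
  by rewrite /= flow_line0.
exact: (is_derive1_comp hb' ha).
Qed.

Context {N : nat} (X : 'I_N -> vector_field A).

(** The derivatives are passed as explicit candidates [u']: on an open set they agree with [Xd] near
    each point, so their continuity transfers to it. *)
Lemma C1P U u (u' : 'I_N -> M -> R) : open U ->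
  (forall x, U x -> {for x, continuous u}) ->
  (forall k x, U x -> is_Xd (X k) u x (u' k x)) ->
  (forall k x, U x -> {for x, continuous (u' k)}) -> C1 X U u.
Proof.
move=> oU cu du cdu; split => // k; split => x Ux.
  exact: is_Xd_derivable (du k x Ux).
have e : \near x, u' k x = Xd (X k) u x.
  apply: filterS (open_nbhs_nbhs (conj oU Ux)) => z Uz.
  by rewrite (is_Xd_val (du k z Uz)).
apply: cvg_trans (_ : u' k @ x --> _); first exact: near_eq_cvg.
by rewrite (is_Xd_val (du k x Ux)); exact: cdu.
Qed.

Lemma C1_is_Xd U u k x : C1 X U u -> U x -> is_Xd (X k) u x (Xd (X k) u x).
Proof. by move=> [_ /(_ k)[du _]] Ux; exact/XdP/du. Qed.

Lemma near_eq_Xd X' u v x : (\near x, u x = v x) -> Xd X' u x = Xd X' v x.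
Proof.
move=> uv; rewrite /Xd !derive1E; apply: near_eq_derive; exact: (near_flow_line X' uv).
Qed.

Lemma eq_C1 U u v : open U -> {in U, u =1 v} -> C1 X U u -> C1 X U v.
Proof.
move=> oU uv [cu du].
have nuv x : U x -> \near x, u x = v x.
  move=> Ux; apply: filterS (open_nbhs_nbhs (conj oU Ux)) => z Uz.
  by apply: uv; rewrite inE.
apply: (@C1P _ _ (fun k => Xd (X k) u)) => // [x Ux|k x Ux|k x Ux].
- apply: cvg_trans (_ : u @ x --> _); first exact/near_eq_cvg/nuv.
  by rewrite -uv ?inE//; exact: cu.
- exact: near_eq_is_Xd (nuv x Ux) (C1_is_Xd _ (conj cu du) Ux).
- by have [_] := du k; apply.
Qed.

Lemma C1M U u v : open U -> C1 X U u -> C1 X U v -> C1 X U (fun x => u x * v x).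
Proof.
move=> oU cu cv; have [cu0 cu1] := cu; have [cv0 cv1] := cv.
apply: (@C1P _ _ (fun k x => u x * Xd (X k) v x + v x * Xd (X k) u x)) => //.
- by move=> x Ux; apply: cvgM; [exact: cu0|exact: cv0].
- by move=> k x Ux; apply: is_XdM; exact: C1_is_Xd Ux.
- move=> k x Ux; have [_ cuk] := cu1 k; have [_ cvk] := cv1 k.
  by apply: cvgD; apply: cvgM; [exact: cu0|exact: cvk|exact: cv0|exact: cuk].
Qed.

Lemma C1_comp U u (phi dphi : R -> R) : open U -> C1 X U u ->
  (forall x, U x -> is_derive (u x) 1 phi (dphi (u x))) ->
  (forall x, U x -> {for u x, continuous dphi}) -> C1 X U (phi \o u).
Proof.
move=> oU cu dp cdp; have [cu0 cu1] := cu.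
apply: (@C1P _ _ (fun k x => dphi (u x) * Xd (X k) u x)) => //.
- move=> x Ux; apply: continuous_comp; first exact: cu0.
  by apply/differentiable_continuous/derivable1_diffP; have [] := dp x Ux.
- by move=> k x Ux; apply: is_Xd_comp; [exact: C1_is_Xd Ux|exact: dp].
- move=> k x Ux; have [_ cuk] := cu1 k; apply: cvgM; last exact: cuk.
  by apply: continuous_comp; [exact: cu0|exact: cdp].
Qed.

End flow_derivative.

(** * The volume measure *)

Section integral_bounds.
Local Open Scope ereal_scope.
Context d (T : measurableType d) (R : realType) (mu : {measure set T -> \bar R}).

(* No measurability is asked of the integrand: the integral of a nonnegative function is a
   supremum over the simple functions below it. *)
Lemma ge0_integral_le_cst (D E : set T) (f : T -> \bar R) (c : R) :
  measurable E -> D `<=` E -> (forall x, D x -> 0 <= f x) ->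
  (forall x, D x -> f x <= c%:E) -> (0 <= c)%R ->
  \int[mu]_(x in D) f x <= c%:E * mu E.
Proof.
move=> mE DE f0 fc c0; rewrite -integral_cst// integral_mkcond [leRHS]integral_mkcond.
rewrite !ge0_integralTE; last 2 first.
- by move=> x; apply: erestrict_ge0 => *; rewrite /= lee_fin.
- exact: erestrict_ge0.
apply: le_ereal_sup => _ [h /= hf <-]; exists h => //= x; apply: (le_trans (hf x)).
rewrite !patchE; case: ifPn => [|_]; last by case: ifPn => //= _; rewrite lee_fin.
by rewrite inE => Dx; rewrite mem_set ?fc//; exact: DE.
Qed.

End integral_bounds.

(** * Lebesgue measure of boxes *)

Section lebesgue_box.
Context {R : realType}.
Local Notation B := (measurableTypeR R).

(** The bounds are indexed by [nat] so that an induction on [n] can shift them by composition with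
    [S]. *)
Definition box n (a b : nat -> R) : set (n.-tuple B) :=
  [set t | forall i : 'I_n, a i <= tnth t i <= b i].

Lemma measurable_box n (a b : nat -> R) : measurable (@box n a b).
Proof.
rewrite (_ : box _ _ = \bigcap_(i in [set: 'I_n]) ((@tnth n B) ^~ i @^-1` `[a i, b i])).
  apply: fin_bigcap_measurable => // i _.
  rewrite -[X in measurable X]setTI; exact: measurable_tnth.
by apply/seteqP; split => [t ht i _ /=|t ht i]; [rewrite in_itv/=; exact: ht|
  have := ht i I; rewrite /= in_itv].
Qed.

Lemma lebesgue_box n (a b : nat -> R) : (forall i, a i <= b i) ->
  lebesgue_tuple n (@box n a b) = (\prod_(i < n) (b i - a i))%:E.
Proof.
elim: n a b => [|n IHn] a b ab.
  rewrite big_ord0 /= /dirac indicE mem_set//= => -[].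
  by case.
rewrite big_ord_recl /= /lebesgue_step /pushforward.
rewrite (_ : _ @^-1` _ = `[a 0%N, b 0%N] `*` @box n (a \o S) (b \o S)).
  rewrite product_measure1E//; last exact: measurable_box.
  rewrite EFinM -(IHn (a \o S) (b \o S)); last by move=> i; exact: ab.
  congr (_ * _)%E; rewrite [LHS]lebesgue_measure_itv/= lte_fin.
  (* A degenerate side falls in the other branch of the formula for intervals, where the length is 0
     as well. *)
  have := ab 0%N; rewrite le_eqVlt => /orP[/eqP ->|->//].
  by rewrite ltxx subrr.
apply/seteqP; split => [[x t] h|[x t] [/= hx h] i].
  split => /=; first by have := h ord0; rewrite /= in_itv.
  by move=> i; have := h (lift ord0 i); rewrite (tnth_nth 0)/= -tnth_nth.
have [j ->|->] := unliftP ord0 i; last by move: hx; rewrite in_itv.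
rewrite (tnth_nth 0)/= -tnth_nth; exact: h.
Qed.

End lebesgue_box.

(** * Null points and finiteness of the volume on compact sets *)

Section volume.
Context {R : realType} {M : ptopologicalType} {m : nat} {A : manifold R M m.+1}.
Context {nu : volume_form A} {mu : {measure set (borel M) -> \bar R}}.
Hypothesis hmu : is_volume_measure nu mu.

Lemma open_measurable_borel (U : set M) : open U -> measurable (U : set (borel M)).
Proof. exact: sub_sigma_algebra. Qed.

Lemma measurable_set1_borel (x : M) : measurable ([set x] : set (borel M)).
Proof.
rewrite -[X in measurable X]setCK; apply: measurableC; apply: open_measurable_borel.
rewrite openC; apply: accessible_closed_set1.
exact: hausdorff_accessible (manifold_hausdorff A).
Qed.

(** In a chart the point is a degenerate box, on which the density is constant. The dimension [m.+1]
    ensures that there is at least one side, of length 0. *)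
Lemma volume_set1 (x : M) : mu ([set x] : set (borel M)) = 0%E.
Proof.
set c := chart_at A x; have cx : cdom c x := cdom_chart_at A x.
have Ac : atlas A c := atlas_chart_at A x.
rewrite (hmu Ac (measurable_set1_borel x)); last by move=> _ ->.
apply/eqP; rewrite eq_le; apply/andP; split; last exact: integral_ge0.
pose a i : R := cfun c x 0 (inord i).
have aE (i : 'I_m.+1) : a i = cfun c x 0 i by rewrite /a inord_val.
apply: (@le_trans _ _ (`|volc nu c x|%:E * lebesgue_tuple m.+1 (@box _ m.+1 a a))%E).
  apply: ge0_integral_le_cst => //.
  - exact: measurable_box.
  - move=> t [_ -> e] i; rewrite aE e mxE. 
    by rewrite lexx.
  - by move=> t [_ -> e]; rewrite -e cfunK.
by rewrite lebesgue_box// big_ord_recl subrr mul0r mule0.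
Qed.

(** Near [x] the absolute density is at most its value at [x] plus 1, and the coordinates stay in a
    box of side 2. *)
Lemma volume_locally_finite (x : M) :
  exists U : set M, [/\ open U, U x & (mu (U : set (borel M)) < +oo)%E].
Proof.
set c := chart_at A x; have cx : cdom c x := cdom_chart_at A x.
have Ac : atlas A c := atlas_chart_at A x.
pose a i : R := cfun c x 0 (inord i).
have aE (i : 'I_m.+1) : a i = cfun c x 0 i by rewrite /a inord_val.
have cvol : {for cfun c x, continuous (volc nu c \o cinv c)}.
  by have [+ _] := @volc_smooth _ _ _ _ nu _ Ac 0%N; apply; exists x.
pose C : R := `|volc nu c x| + 1.
pose P := [set z | [/\ cdom c z, `|volc nu c z| <= C & ball (cfun c x) 1 (cfun c z)]].
have nP : nbhs x P.
  have n1 : nbhs x (cdom c) by apply: open_nbhs_nbhs; split => //; exact: open_cdom.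
  have n2 : \forall z \near x, ball (cfun c x) 1 (cfun c z).
    exact: (cfun_continuous cx (nbhsx_ballx (cfun c x) _ ltr01)).
  have n3 : \forall v \near cfun c x, `|volc nu c (cinv c v)| < C.
    have : `|(volc nu c \o cinv c) v| @[v --> cfun c x] --> `|volc nu c x|.
      have -> : volc nu c x = (volc nu c \o cinv c) (cfun c x) by rewrite /= cfunK.
      exact: (cvg_norm cvol).
    by move/cvgr_lt; apply; rewrite /C ltrDl.
  have n4 : \near x, `|volc nu c (cinv c (cfun c x))| < C by exact: (cfun_continuous cx n3).
  near=> z; have cz : cdom c z by near: z.
  split => //; last by near: z.
  by apply: ltW; rewrite -{1}(cfunK cz); near: z.
exists P^°; split; [exact: open_interior|exact: nP|].
have PU := @interior_subset _ P.
rewrite (hmu Ac (open_measurable_borel (@open_interior _ P))); last by move=> z /PU[].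
pose lo i : R := a i - 1; pose hi i : R := a i + 1.
apply: (@le_lt_trans _ _ (C%:E * lebesgue_tuple m.+1 (@box _ m.+1 lo hi))%E).
  apply: ge0_integral_le_cst => //.
  - exact: measurable_box.
  - move=> t [z /PU[cz _ bz] e] i; rewrite /lo /hi aE.
    have := bz.2 0 i; rewrite e mxE /ball/= ltr_distlC => /andP[? ?].
    by rewrite !ltW.
  - by move=> t [z /PU[cz Cz _] <-]; rewrite cfunK// lee_fin.
  - by rewrite addr_ge0.
by rewrite lebesgue_box ?ltry// => i; rewrite lerD2l; lra.
Unshelve. all: by end_near. Qed.

Lemma volume_compact (K D : set M) : compact K -> measurable (D : set (borel M)) -> D `<=` K ->
  (mu (D : set (borel M)) < +oo)%E.
Proof.
have [U hU] := choice volume_locally_finite.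
rewrite compact_cover => /(_ M [set: M] U); case.
- by move=> x _; have [] := hU x.
- by move=> x _; exists x => //; have [] := hU x.
move=> F _ KF mD DK.
apply: le_lt_trans (content_sub_fsum mu (finite_fset F) (A_ := U : M -> set (borel M)) _ mD _) _.
- by move=> i _; apply: open_measurable_borel; have [] := hU i.
- exact: subset_trans DK KF.
- by rewrite fsbig_finite//; apply/lte_sum_pinfty => i _; have [] := hU i.
Qed.

End volume.

(** * Continuity relative to a subset *)

Section within_continuity.
Context {R : realType} {M : topologicalType}.
Implicit Types (K : set M) (f g : M -> R).

Lemma within_continuousM K f g : {within K, continuous f} ->
  {within K, continuous g} -> {within K, continuous (fun x => f x * g x)}.
Proof.
move=> /subspace_continuousP cf /subspace_continuousP cg.
by apply/subspace_continuousP => x Kx; apply: cvgM; [exact: cf|exact: cg].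
Qed.

Lemma within_continuous_comp K f (phi : R -> R) : {within K, continuous f} ->
  (forall x, K x -> {for f x, continuous phi}) ->
  {within K, continuous (phi \o f)}.
Proof.
move=> /subspace_continuousP cf cphi.
by apply/subspace_continuousP => x Kx; apply: continuous_cvg; [exact: cphi|exact: cf].
Qed.

(** Used to carry the bound on [d], given by a supremum over the punctured domain, to the boundary,
    where the logarithmic weight is evaluated as well. *)
Lemma within_continuous_le E K f (c : R) : {within K, continuous f} -> E `<=` K ->
  K `<=` closure E -> (forall x, E x -> f x <= c) -> forall x, K x -> f x <= c.
Proof.
move=> /subspace_continuousP cf EK KE fc x Kx.
rewrite leNgt; apply/negP => fx.
have : \forall z \near within K (nbhs x), c < f z.
  by have /cvgr_gt := cf x Kx; apply.
rewrite near_withinE => /(KE x Kx)[z [Ez /(_ (EK z Ez))]].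
by rewrite ltNge fc.
Qed.

Lemma bounded_compactD K U f : compact K -> open U ->
  {within K `\` U, continuous f} -> exists C, forall x, K x -> ~ U x -> `|f x| <= C.
Proof.
move=> cK oU cf.
have cKU : compact (K `\` U).
  rewrite setDE; apply: compact_closedI => //; exact: open_closedC.
have [C [_ hC]] := compact_bounded (continuous_compact cf cKU).
exists (`|C| + 1) => x Kx Ux; apply: hC; last by exists x.
by rewrite (le_lt_trans (ler_norm _))// ltrDl.
Qed.

End within_continuity.

Lemma cvg_sum_ord {R : realType} {T : Type} (F : set_system T) {FF : Filter F} (n : nat)
    (f : 'I_n -> T -> R) (l : 'I_n -> R) :
  (forall k, f k @ F --> l k) -> (fun x => \sum_k f k x) @ F --> \sum_k l k.
Proof.
move=> fl; elim: (index_enum _) => [|k s IHs].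
  rewrite big_nil; under eq_fun do rewrite big_nil.
  exact: cvg_cst.
rewrite big_cons; under eq_fun do rewrite big_cons.
by apply: cvgD.
Qed.

(** * Measurability and integrability for the volume measure *)

Section volume_integrals.
Context {R : realType} {M : ptopologicalType} {m : nat} {A : manifold R M m.+1}.
Context {nu : volume_form A} {mu : {measure set (borel M) -> \bar R}}.
Implicit Types (D : set (borel M)) (f g : borel M -> R).

Lemma continuous_measurable_borel (D : set M) (f : M -> R) : open D ->
  (forall x, D x -> {for x, continuous f}) ->
  measurable_fun (D : set (borel M)) (f : borel M -> R).
Proof.
move=> oD cf; apply: (measurability _ (RGenOpens.measurableE R)).
move=> _ [_ [a [b ->] <-]]; apply: open_measurable_borel.
rewrite openE => x [Dx abx]; apply: filterI; first exact: open_nbhs_nbhs.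
apply: (cf x Dx); apply: open_nbhs_nbhs; split => //; exact: interval_open.
Qed.

Lemma integrable_measurable_borel D f : mu.-integrable D (EFin \o f) -> measurable_fun D f.
Proof. by move=> /integrableP[/measurable_EFinP]. Qed.

Lemma dominated_integrable_borel D f g : measurable D -> measurable_fun D f ->
  (forall x, D x -> `|f x| <= g x) -> mu.-integrable D (EFin \o g) ->
  mu.-integrable D (EFin \o f).
Proof.
move=> mD mf fg; apply: le_integrable => //; first exact/measurable_EFinP.
by move=> x Dx; rewrite /= lee_fin (le_trans (fg x Dx))// ler_norm.
Qed.

Lemma bounded_integrable_borel D f (C : R) : measurable D -> measurable_fun D f ->
  (mu D < +oo)%E -> (forall x, D x -> `|f x| <= C) -> mu.-integrable D (EFin \o f).
Proof.
move=> mD mf muD fC; apply: measurable_bounded_integrable => //.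
exists C; split; first exact: num_real.
by move=> c Cc x Dx; exact: (le_trans (fC x Dx) (ltW Cc)).
Qed.

Lemma integrableD_borel D f g : measurable D -> mu.-integrable D (EFin \o f) ->
  mu.-integrable D (EFin \o g) -> mu.-integrable D (EFin \o (fun x => f x + g x)).
Proof. by move=> mD fi gi; exact: (integrableD mD fi gi). Qed.

Lemma integrableZ_borel D f (c : R) : measurable D -> mu.-integrable D (EFin \o f) ->
  mu.-integrable D (EFin \o (fun x => c * f x)).
Proof. by move=> mD fi; exact: (integrableZl mD c fi). Qed.

Lemma integrable_norm_borel D f : mu.-integrable D (EFin \o f) ->
  mu.-integrable D (EFin \o (fun x => `|f x|)).
Proof. exact: integrable_norm. Qed.

Hypothesis hmu : is_volume_measure nu mu.

(** Any function is measurable on a singleton, so the arbitrary value at the pole does no harm. *)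
Lemma measurable_funD1_borel D (y : M) f : open (D : set M) ->
  measurable_fun (D `\ y) f -> measurable_fun D f.
Proof.
move=> oD mf; have my := measurable_set1_borel (A := A) y.
have mD := open_measurable_borel oD.
have [Dy|Dy] := pselect (D y); last by rewrite -(not_setD1 Dy).
rewrite -(setD1K Dy); apply/measurable_funU => //; first exact: measurableD.
by split => //; exact: measurable_fun_set1.
Qed.

Lemma integrableD1_borel D (y : M) f : open (D : set M) ->
  mu.-integrable (D `\ y) (EFin \o f) -> mu.-integrable D (EFin \o f).
Proof.
move=> oD fi; have my := measurable_set1_borel (A := A) y.
apply/(negligible_integrable my) => //; first exact: open_measurable_borel.
  apply/measurable_EFinP; exact: (measurable_funD1_borel oD (integrable_measurable_borel fi)).
exact: (volume_set1 hmu).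
Qed.

Lemma RintegralD1_borel D (y : M) f : open (D : set M) ->
  mu.-integrable (D `\ y) (EFin \o f) ->
  \int[mu]_(x in D) f x = \int[mu]_(x in D `\ y) f x.
Proof.
move=> oD fi; have my := measurable_set1_borel (A := A) y.
congr fine; apply: negligible_integral => //.
- exact: open_measurable_borel.
- exact: integrableD1_borel fi.
- exact: (volume_set1 hmu).
Qed.

Lemma ge0_integralD1_borel D (y : M) (f : borel M -> \bar R) : open (D : set M) ->
  measurable_fun (D `\ y) f -> (forall x, D x -> (0 <= f x)%E) ->
  (\int[mu]_(x in D) f x = \int[mu]_(x in D `\ y) f x)%E.
Proof.
move=> oD mf f0; have my := measurable_set1_borel (A := A) y.
have mD := open_measurable_borel oD.
apply: ge0_negligible_integral => //; last exact: (volume_set1 hmu).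
have [Dy|Dy] := pselect (D y); last by rewrite -(not_setD1 Dy).
rewrite -(setD1K Dy); apply/measurable_funU => //; first exact: measurableD.
by split => //; exact: measurable_fun_set1.
Qed.

End volume_integrals.

(** * Divergence formulas with a pole *)

Section pole.
Context {R : realType} {M : ptopologicalType} {m : nat} {A : manifold R M m.+1}.
Context {nu : volume_form A} {mu : {measure set (borel M) -> \bar R}}.
Context {N : nat} {X : 'I_N -> vector_field A}.
Context {y : M} {T : set M} {G : M -> R} {Om : set M} {B : cells (A := A) (boundary Om)}.
Hypothesis hmu : is_volume_measure nu mu.
Hypothesis hA : assumption_Aplus X nu mu y T G.
Hypothesis hy : ~ boundary Om y.
Hypothesis hOm : strongly_admissible X nu mu y T G B.

Let D : set M := Om `\ y.
Let K : set M := closure Om `\ y.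

Let oOm : open Om. Proof. by case: hOm => -[[]]. Qed.
Let cOm : compact (closure Om). Proof. by case: hOm => -[[]]. Qed.
Let closed1 : closed [set y].
Proof.
by apply: accessible_closed_set1; exact: hausdorff_accessible (manifold_hausdorff A).
Qed.

Lemma open_punctured : open D.
Proof. by rewrite /D setDE; apply: openI => //; exact: closed_openC. Qed.

Lemma punctured_subset : D `<=` K.
Proof. by move=> x [Ox xy]; split => //; exact: subset_closure. Qed.

Lemma closure_punctured x : K x -> closure D x.
Proof.
move=> [cx xy] V Vx.
have [z [Oz [Vz zy]]] : Om `&` (V `&` ~` [set y]) !=set0.
  by apply: cx; apply: filterI => //; apply: open_nbhs_nbhs; split => //; exact: closed_openC.
by exists z.
Qed.

Lemma fundamental_gt0 x : K x -> 0 < G x.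
Proof.
move=> [cx xy]; have [_ sub _ bG _] := hOm; have [_ Gpos _] := hA.
have [Ox|nOx] := pselect (Om x); first by apply: Gpos; split => //; exact: sub.
by apply: bG; split => //; split => // /interior_subset.
Qed.

Lemma fundamental_C1 : C1 X D G.
Proof. by have [_ _ [cG _ _] _ _] := hOm. Qed.

Lemma fundamental_within : {within K, continuous G}.
Proof. by have [_ _ [_ cG _] _ _] := hOm. Qed.

Lemma near_pole (c : R) : exists U : set M,
  [/\ open U, U y & forall x, U x -> x <> y -> c < G x].
Proof.
have [[oT Ty _ _] Gpos Ginv] := hA.
(* Comparing inverses requires a positive threshold, whereas [c] is arbitrary. *)
pose c' := Num.max c 1.
have c'0 : 0 < c' by rewrite lt_max ltr01 orbT.
have hG : \forall x \near y^', (G x)^-1 < c'^-1.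
  by move/cvgr_lt : Ginv; apply; rewrite invr_gt0.
have : nbhs y [set x | x != y -> (G x)^-1 < c'^-1] by exact: hG.
rewrite nbhsE => -[V [oV Vy] hV].
exists (V `&` T); split; [exact: openI|by []|].
move=> x [Vx Tx] xy; have /hV := Vx; move/eqP: (xy) => xy' /(_ xy').
have G0 : 0 < G x by exact: Gpos.
by rewrite ltf_pV2 ?posrE//; apply: le_lt_trans; rewrite le_max lexx.
Qed.

Lemma bounded_off_pole (U : set M) (f : M -> R) : open U -> U y ->
  {within K, continuous f} -> exists C, forall x, closure Om x -> ~ U x -> `|f x| <= C.
Proof.
move=> oU Uy cf; apply: bounded_compactD => //.
apply: continuous_subspaceW cf => x [cx Ux]; split => // xy.
by apply: Ux; rewrite xy.
Qed.

(** Near the pole [G > 1]; away from it [G^-1] is continuous on a compact set, hence bounded. *)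
Lemma fundamental_lbound : exists2 c, 0 < c & forall x, K x -> c <= G x.
Proof.
have [U [oU Uy UG]] := near_pole 1.
have [C hC] : exists C, forall x, closure Om x -> ~ U x -> `|(G x)^-1| <= C.
  apply: bounded_off_pole => //.
  apply: (within_continuous_comp (phi := GRing.inv)) fundamental_within _.
  by move=> x Kx; apply: inv_continuous; rewrite gt_eqF// fundamental_gt0.
pose C' := Num.max C 1; have C'0 : 0 < C' by rewrite lt_max ltr01 orbT.
exists C'^-1; first by rewrite invr_gt0.
move=> x Kx; have G0 := fundamental_gt0 Kx; case: (Kx) => cx xy.
rewrite -[leRHS]invrK lef_pV2 ?posrE ?invr_gt0// le_max; apply/orP.
have [Ux|Ux] := pselect (U x); [right|left].
  by rewrite invf_le1// ltW// UG.
by rewrite (le_trans _ (hC _ cx Ux))// ler_norm.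
Qed.

(** As [y] is off the boundary, the complement of the boundary can serve as the neighbourhood of the
    pole outside of which [G] is bounded. Late cutoffs therefore equal 1 on the boundary and leave
    boundary integrals unchanged. *)
Lemma fundamental_boundary : exists n0 : nat, forall n x, (n0 <= n)%N ->
  boundary Om x -> G x <= n.+1%:R.
Proof.
have oU : open (~` boundary Om).
  rewrite openC /boundary setDE; apply: closedI; first exact: closed_closure.
  by apply: open_closedC; exact: open_interior.
have [C hC] := bounded_off_pole oU hy fundamental_within.
exists (Num.trunc `|C|).+1 => n x n0n bx.
have bcx : closure Om x by case: bx.
have := hC x bcx (fun h => h bx); move/ler_normlW/le_trans; apply.
apply: (le_trans (ler_norm C)); apply: (@le_trans _ _ (Num.trunc `|C|).+1%:R).
  by rewrite ltW// truncnS_gt.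
by rewrite ler_nat (leq_trans n0n).
Qed.

Lemma volume_punctured : (mu (D : set (borel M)) < +oo)%E.
Proof.
apply: (volume_compact hmu cOm); first by apply: open_measurable_borel; exact: open_punctured.
by apply: subset_trans punctured_subset _ => x [].
Qed.

Let cut n x := cutoff (G x / n.+1%:R).
(** The combination [s * dcutoff s] for [s = G / n.+1]: off the pole, the derivative of [cut n] is
    [dcut n / G] times that of [G]. In this form the factor [dcut n] is bounded by 8 and tends to 0
    pointwise. *)
Let dcut n x := G x / n.+1%:R * dcutoff (G x / n.+1%:R).

(** The value at [y] is prescribed because [G y] and [h y] are arbitrary. Since [cut n] vanishes
    around [y], the truncation is identically 0 near the pole. *)
Definition truncate n (h : M -> R) x := if x == y then 0 else h x * cut n x.

Lemma near_pole_cut n : exists U : set M,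
  [/\ open U, U y & forall x, U x -> x <> y -> cut n x = 0 /\ dcut n x = 0].
Proof.
have [U [oU Uy UG]] := near_pole (2 * n.+1%:R); exists U; split => // x Ux xy.
have G2 : 2 <= G x / n.+1%:R by rewrite ler_pdivlMr ?ltr0n// ltW// UG.
by rewrite /cut /dcut cutoff_eq0// dcutoff_eq0 ?mulr0//; right.
Qed.

Lemma near_neq_pole x : x <> y -> \forall z \near x, (z == y) = false.
Proof.
move=> xy; have : nbhs x (~` [set y]).
  by apply: open_nbhs_nbhs; split => //; exact: closed_openC.
by apply: filterS => z /eqP/negbTE.
Qed.

Lemma near_truncate_pole n h : \forall z \near y, 0 = truncate n h z.
Proof.
have [U [oU Uy UG]] := near_pole_cut n.
apply: filterS (open_nbhs_nbhs (conj oU Uy)) => z Uz.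
by rewrite /truncate; case: eqP => // zy; have [->] := UG z Uz zy; rewrite mulr0.
Qed.

Lemma near_truncate n h x : x <> y -> \forall z \near x, h z * cut n z = truncate n h z.
Proof. by move=> /near_neq_pole; apply: filterS => z; rewrite /truncate => ->. Qed.

Let is_Xd_cut n k x : D x -> is_Xd (X k) (cut n) x
  (dcutoff (G x / n.+1%:R) / n.+1%:R * Xd (X k) G x).
Proof.
move=> Dx; have cG := C1_is_Xd k fundamental_C1 Dx.
exact: (is_Xd_comp cG (is_derive_cutoff_scale _ _)).
Qed.

Lemma is_Xd_truncate n h k x : C1 X D h -> D x ->
  is_Xd (X k) (truncate n h) x
    (cut n x * Xd (X k) h x + h x / G x * dcut n x * Xd (X k) G x).
Proof.
move=> ch Dx; have G0 := fundamental_gt0 (punctured_subset Dx).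
apply: (near_eq_is_Xd (near_truncate n h Dx.2)).
have := is_XdM (C1_is_Xd k ch Dx) (is_Xd_cut n k Dx).
congr (is_Xd _ _ _ _); rewrite /dcut [LHS]addrC; congr (_ + _).
have c0 : n.+1%:R != 0 :> R by rewrite pnatr_eq0.
move: (lt0r_neq0 G0) c0; move: (G x) (n.+1%:R) => a c a0 c0.
by field; rewrite a0 c0.
Qed.

Lemma is_Xd_truncate_pole n h k : is_Xd (X k) (truncate n h) y 0.
Proof. exact: (near_eq_is_Xd (near_truncate_pole n h) (is_Xd_cst _ _ _)). Qed.

Let continuous_cut n x : D x -> {for x, continuous (cut n)}.
Proof.
move=> Dx; have [cG _] := fundamental_C1.
apply: (@continuous_comp _ _ _ (fun z => G z / n.+1%:R) cutoff).
  by apply: cvgM; [exact: cG|exact: cvg_cst].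
exact: continuous_cutoff.
Qed.

Let continuous_dcut n x : D x -> {for x, continuous (dcut n)}.
Proof.
move=> Dx; have [cG _] := fundamental_C1.
have cGn : {for x, continuous (fun z => G z / n.+1%:R)}.
  by apply: cvgM; [exact: cG|exact: cvg_cst].
apply: cvgM => //; apply: (@continuous_comp _ _ _ (fun z => G z / n.+1%:R) dcutoff) => //.
exact: continuous_dcutoff.
Qed.

Let dtruncate n h k x := if x == y then 0 else
  cut n x * Xd (X k) h x + h x / G x * dcut n x * Xd (X k) G x.

(** Near the pole the truncation is constant, elsewhere it is a product of C^1 functions. It is
    thereby a legitimate test function for divergence formulas stated on all of [Om]. *)
Lemma truncate_C1 n h : C1 X D h -> C1 X Om (truncate n h).
Proof.
move=> ch; have [cG /all_and2[dG cdG]] := fundamental_C1.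
have [chh /all_and2[dh cdh]] := ch.
apply: (@C1P _ _ _ _ _ _ _ _ (dtruncate n h)) => // [x Ox|k x Ox|k x Ox].
- have [->|xy] := pselect (x = y).
    apply: cvg_trans (_ : cst 0 @ y --> _); first exact/near_eq_cvg/near_truncate_pole.
    by rewrite /truncate eqxx; exact: cvg_cst.
  have Dx : D x by [].
  apply: cvg_trans (_ : (fun z => h z * cut n z) @ x --> _).
    exact/near_eq_cvg/near_truncate.
  rewrite /truncate; move/eqP/negbTE : xy => ->.
  by apply: cvgM; [exact: chh|exact: continuous_cut].
- rewrite /dtruncate; case: eqP => [->|xy]; first exact: is_Xd_truncate_pole.
  by apply: is_Xd_truncate.
- have [->|xy] := pselect (x = y).
    apply: cvg_trans (_ : cst 0 @ y --> _); last first.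
      by rewrite /dtruncate eqxx; exact: cvg_cst.
    apply: near_eq_cvg; have [U [oU Uy UG]] := near_pole_cut n.
    apply: filterS (open_nbhs_nbhs (conj oU Uy)) => z Uz.
    rewrite /dtruncate; case: eqP => // zy; have [-> ->] := UG z Uz zy.
    by rewrite mul0r mulr0 mul0r addr0.
  have Dx : D x by [].
  apply: cvg_trans (_ : (fun x => cut n x * Xd (X k) h x + h x / G x * dcut n x * Xd (X k) G x) @ x --> _).
    apply: near_eq_cvg; apply: filterS (near_neq_pole xy) => z.
    by rewrite /dtruncate => ->.
  rewrite /dtruncate; move/eqP/negbTE : xy => ->.
  apply: cvgD; first by apply: cvgM; [exact: continuous_cut|exact: cdh].
  apply: cvgM; last exact: cdG.
  apply: cvgM; last exact: continuous_dcut.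
  apply: cvgM; first exact: chh.
  by apply: cvgV; [rewrite gt_eqF// fundamental_gt0//; exact: punctured_subset|exact: cG].
Qed.

Lemma truncate_within n h : {within K, continuous h} ->
  {within closure Om, continuous (truncate n h)}.
Proof.
move=> ch; apply/subspace_continuousP => x cx.
change (truncate n h @ within (closure Om) (nbhs x) --> truncate n h x).
have [->|xy] := pselect (x = y).
  apply: cvg_trans (_ : cst 0 @ within (closure Om) (nbhs y) --> _).
    by apply: near_eq_cvg; apply: cvg_within; exact: near_truncate_pole.
  by rewrite /truncate eqxx; exact: cvg_cst.
have Kx : K x by [].
have chc : {within K, continuous (fun z => h z * cut n z)}.
  apply: within_continuousM => //.
  apply: (within_continuous_comp (phi := fun s => cutoff (s / n.+1%:R))).
    exact: fundamental_within.
  by move=> z _; exact: continuous_cutoff_scale.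
have /subspace_continuousP/(_ x Kx) : {within K, continuous (fun z => h z * cut n z)} := chc.
rewrite {2}/truncate; move/eqP/negbTE : (xy) => ->.
apply: cvg_trans.
apply: cvg_trans (_ : (fun z => h z * cut n z) @ within (closure Om) (nbhs x) --> _).
  by apply: near_eq_cvg; apply: cvg_within; exact: near_truncate.
(* Small neighbourhoods of [x] avoid [y], so they have the same trace on [K] as on [closure Om]. *)
apply: cvg_app => V hV; have hV' : nbhs x [set z | K z -> V z] := hV.
change (nbhs x [set z | closure Om z -> V z]).
apply: filterS (filterI hV' (near_neq_pole xy)) => z /= [+ /eqP zy] cz.
by apply; split.
Qed.

(** * Removal of the cutoff in the limit *)

Let intD (f : M -> R) := mu.-integrable (D : set (borel M)) (EFin \o (f : borel M -> R)).
Let measD (f : M -> R) := measurable_fun (D : set (borel M)) (f : borel M -> R).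

Let mD : measurable (D : set (borel M)).
Proof. by apply: open_measurable_borel; exact: open_punctured. Qed.

Let measC (f : M -> R) : (forall x, D x -> {for x, continuous f}) -> measD f.
Proof. by move=> cf; apply: continuous_measurable_borel => //; exact: open_punctured. Qed.

Let cutDcut n x (a b : R) : `|cut n x * a + dcut n x * b| <= `|a| + 8 * `|b|.
Proof.
apply: (le_trans (ler_normD _ _)); rewrite (normrM (cut n x)) (normrM (dcut n x)); apply: lerD.
  have c0 : 0 <= cut n x := cutoff_ge0 _; have c1 : cut n x <= 1 := cutoff_le1 _.
  by rewrite (ger0_norm c0) ler_piMl.
by apply: ler_wpM2r => //; exact: norm_mul_dcutoff.
Qed.

(** As soon as [n.+1] exceeds [G x] the argument of the cutoff is at most 1, so both sequences are
    eventually constant at each point. *)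
Let cut_near x : D x -> \forall n \near \oo, cut n x = 1 /\ dcut n x = 0.
Proof.
move=> Dx; have G0 := fundamental_gt0 (punctured_subset Dx).
near=> n; have Gn : G x / n.+1%:R <= 1.
  rewrite ler_pdivrMr ?ltr0n// mul1r.
  apply: (@le_trans _ _ (Num.trunc (G x)).+1%:R); first by rewrite ltW// truncnS_gt.
  by rewrite ler_nat ltnS; near: n; exact: nbhs_infty_ge.
by rewrite /cut /dcut cutoff_eq1// dcutoff_eq0 ?mulr0//; left.
Unshelve. all: by end_near. Qed.

Lemma integral_cut_cvg (f1 f2 : M -> R) : intD f1 -> intD f2 ->
  (\int[mu]_(x in (D : set (borel M))) (cut n x * f1 x + dcut n x * f2 x)%:E)%E
    @[n --> \oo] --> (\int[mu]_(x in (D : set (borel M))) (f1 x)%:E)%E.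
Proof.
move=> i1 i2.
have mf1 : measD f1 := integrable_measurable_borel i1.
have mf2 : measD f2 := integrable_measurable_borel i2.
have mc n : measD (cut n) by apply: measC => x; exact: continuous_cut.
have mdc n : measD (dcut n) by apply: measC => x; exact: continuous_dcut.
have [|//|||//|_ _] := @dominated_convergence _ (borel M) R mu D mD
    (fun n x => (cut n x * f1 x + dcut n x * f2 x)%:E) (EFin \o f1)
    (EFin \o (fun x => `|f1 x| + 8 * `|f2 x|)).
- move=> n; apply/measurable_EFinP; apply: measurable_funD.
    by apply: measurable_funM; [exact: mc|exact: mf1].
  by apply: measurable_funM; [exact: mdc|exact: mf2].
- exact/measurable_EFinP.
- apply: aeW => x Dx; apply: cvg_near_cst.
  by apply: filterS (cut_near Dx) => n [-> ->]; rewrite mul1r mul0r addr0.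
- apply: integrableD_borel => //; first exact: integrable_norm_borel.
  by apply: integrableZ_borel => //; exact: integrable_norm_borel.
- by apply: aeW => x n Dx; rewrite /= lee_fin.
by [].
Qed.

(** The truncated integrals keep the same boundary value from [n0] on, so it is also the limit.
    Their integrability follows from the domination by [|f1| + 8 |f2|] and is handed to the
    hypothesis as a premise. *)
Lemma integral_cut_eq (f1 f2 : M -> R) (c : R) n0 : intD f1 -> intD f2 ->
  (forall n, (n0 <= n)%N -> intD (fun x => cut n x * f1 x + dcut n x * f2 x) ->
    \int[mu]_(x in (D : set (borel M))) (cut n x * f1 x + dcut n x * f2 x) = c) ->
  \int[mu]_(x in (D : set (borel M))) f1 x = c.
Proof.
move=> i1 i2 hc; have cv := integral_cut_cvg i1 i2.
have cv' : (\int[mu]_(x in (D : set (borel M))) (cut n x * f1 x + dcut n x * f2 x)%:E)%E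
    @[n --> \oo] --> c%:E.
  apply: cvg_near_cst; exists n0 => // n /= n0n.
  have fi : intD (fun x => cut n x * f1 x + dcut n x * f2 x).
    apply: (@dominated_integrable_borel _ _ _ _ _ (fun x => `|f1 x| + 8 * `|f2 x|)) => //.
    - apply: measurable_funD; apply: measurable_funM.
      + by apply: measC => x; exact: continuous_cut.
      + exact: integrable_measurable_borel i1.
      + by apply: measC => x; exact: continuous_dcut.
      + exact: integrable_measurable_borel i2.
    - apply: integrableD_borel => //; first exact: integrable_norm_borel.
      by apply: integrableZ_borel => //; exact: integrable_norm_borel.
  by rewrite -(hc n n0n fi) /Rintegral fineK//; exact: (integrable_fin_num mD fi).
by rewrite /Rintegral (cvg_unique _ cv cv').
Qed.

(** Cells send the open cube into the boundary by [cell_cover], so a form is only read at boundary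
    points. *)
Lemma eq_int_form (w w' : mform (R := R) (M := M) (m := m)) :
  (forall x W, boundary Om x -> w x W = w' x W) -> int_form B w = int_form B w'.
Proof.
move=> ww'; apply: eq_bigr => j _; congr (_ * _); apply: eq_Rintegral => t.
rewrite inE /in_cube/= => ht; rewrite /pullback ww'//.
suff : (\bigcup_i (@cell _ _ _ _ _ B i @` @closed_cube R m)) (cell j (rV_of t)).
  by rewrite cell_cover.
exists j => //; exists (rV_of t) => // i.
by have /andP[/ltW -> /ltW ->] := ht i.
Qed.

Let cut_boundary : exists n0, forall n x, (n0 <= n)%N -> boundary Om x -> cut n x = 1.
Proof.
have [n0 hn0] := fundamental_boundary; exists n0 => n x n0n bx.
by rewrite /cut cutoff_eq1// ler_pdivrMr ?ltr0n// mul1r hn0.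
Qed.

Lemma truncate_boundary : exists n0, forall n x h, (n0 <= n)%N -> boundary Om x ->
  truncate n h x = h x.
Proof.
have [n0 hn0] := cut_boundary; exists n0 => n x h n0n bx.
rewrite /truncate hn0// mulr1; case: eqP => // xy.
by move: bx; rewrite xy.
Qed.

Lemma Rintegral_Om_D (f g : M -> R) : (forall x, D x -> f x = g x) -> intD g ->
  mu.-integrable (Om : set (borel M)) (EFin \o (f : borel M -> R)) /\
  \int[mu]_(x in (Om : set (borel M))) f x = \int[mu]_(x in (D : set (borel M))) g x.
Proof.
move=> fg gi; have fi : intD f.
  by apply: eq_integrable gi => // x; rewrite inE /= => Dx; rewrite fg.
split; first exact: (integrableD1_borel hmu oOm fi).
rewrite (RintegralD1_borel hmu oOm fi); apply: eq_Rintegral => x.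
by rewrite inE; exact: fg.
Qed.

(** Kept apart from its limit [strong_divergence], because the integrability that the limit requires
    is itself deduced from the truncated formula in [powR_sqgrad_integrable]. *)
Lemma strong_divergence_cut : exists n0, forall n h, (n0 <= n)%N ->
  C1 X D h -> {within K, continuous h} ->
  let P x := \sum_k Xd (X k) h x * Xd (X k) G x in
  let Q x := h x / G x * sqgrad X G x in
  intD (fun x => cut n x * P x + dcut n x * Q x) ->
  \int[mu]_(x in (D : set (borel M))) (cut n x * P x + dcut n x * Q x) =
    int_form B (scale_form h (grad_form X nu Om G)).
Proof.
have [n0 hn0] := truncate_boundary; exists n0 => n h n0n ch wh P Q fi.
have [_ _ _ _ sadm] := hOm.
have e x : D x -> \sum_k Xd (X k) (truncate n h) x * Xd (X k) G x =
    cut n x * P x + dcut n x * Q x.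
  move=> Dx; rewrite /P /Q /sqgrad !mulr_sumr -big_split/=; apply: eq_bigr => k _.
  by rewrite (is_Xd_val (is_Xd_truncate n k ch Dx)); ring.
have [i1 e1] := Rintegral_Om_D e fi.
have := sadm _ (truncate_C1 n ch) (truncate_within wh) i1.
(* The truncation is 0 at [y], which removes the Dirac term whether or not [y] lies in [Om]. *)
rewrite e1 {1}/truncate eqxx mul0r subr0 => ->.
by apply: eq_int_form => x W bx; rewrite /scale_form hn0.
Qed.

Lemma strong_divergence h :
  C1 X D h -> {within K, continuous h} ->
  let P x := \sum_k Xd (X k) h x * Xd (X k) G x in
  intD P -> intD (fun x => h x / G x * sqgrad X G x) ->
  \int[mu]_(x in (D : set (borel M))) P x =
    int_form B (scale_form h (grad_form X nu Om G)).
Proof.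
move=> ch wh P i1 i2; have [n0 hn0] := strong_divergence_cut.
by apply: (integral_cut_eq (n0 := n0) i1 i2) => n n0n fi; exact: (hn0 n h n0n ch wh fi).
Qed.

(** For components unrelated to [dG], plain admissibility applies to each truncated [h k]; the error
    term of the cutoff is the product of the field with [dG / G]. *)
Lemma divergence_flux (h : 'I_N -> M -> R) :
  (forall k, C1 X D (h k)) -> (forall k, {within K, continuous (h k)}) ->
  let P x := \sum_k Xd (X k) (h k) x in
  intD P -> intD (fun x => \sum_k h k x / G x * Xd (X k) G x) ->
  \int[mu]_(x in (D : set (borel M))) P x = int_form B (flux_form X nu h).
Proof.
move=> ch wh P i1 i2; have [n0 hn0] := truncate_boundary.
apply: (integral_cut_eq (n0 := n0) i1 i2) => n n0n fi.
have [[[_ _ _ _ adm] _] _ _ _ _] := hOm.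
have e x : D x -> \sum_k Xd (X k) (truncate n (h k)) x =
    cut n x * P x + dcut n x * \sum_k h k x / G x * Xd (X k) G x.
  move=> Dx; rewrite /P !mulr_sumr -big_split/=; apply: eq_bigr => k _.
  by rewrite (is_Xd_val (is_Xd_truncate n k (ch k) Dx)); ring.
have [j1 e1] := Rintegral_Om_D e fi.
rewrite -e1 (adm (fun k => truncate n (h k)))//.
  apply: eq_int_form => x W bx; apply: eq_bigr => k _; by rewrite hn0.
by move=> k; split; [exact: truncate_C1|exact: truncate_within].
Qed.

(** * Gradient and powers of the fundamental solution *)

Lemma fundamental_grad_bounded (U : set M) : open U -> U y ->
  exists C, forall x, D x -> ~ U x -> sqgrad X G x <= C.
Proof.
move=> oU Uy; have [_ _ [_ _ gG] _ _] := hOm.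
have /choice[C hC] : forall k : 'I_N, exists C, forall x, D x -> ~ U x -> `|Xd (X k) G x| <= C.
  move=> k; have [g cg eg] := gG k; have [C hC] := bounded_off_pole oU Uy cg.
  exists C => x Dx Ux; rewrite -eg//; apply: hC => //.
  by have [] := punctured_subset Dx.
exists (\sum_k C k ^+ 2) => x Dx Ux; apply: ler_sum => k _.
by rewrite -real_normK ?num_real// lerXn2r ?nnegrE ?hC// (le_trans _ (hC k x Dx Ux)).
Qed.

Lemma sqgrad_continuous x : D x -> {for x, continuous (sqgrad X G)}.
Proof.
move=> Dx; have [_ /all_and2[_ cdG]] := fundamental_C1.
by apply: cvg_sum_ord => k; under eq_fun do rewrite expr2; apply: cvgM; exact: cdG.
Qed.

Lemma powR_derivable (q : R) x : K x ->
  is_derive (G x) 1 (@powR R ^~ q) (q * G x `^ (q - 1)).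
Proof. by move=> Kx; apply: is_derive1_powR; exact: fundamental_gt0. Qed.

Lemma powR_continuous (q : R) x : K x -> {for G x, continuous (@powR R ^~ q)}.
Proof.
move=> Kx; apply/differentiable_continuous/derivable1_diffP.
by have [] := powR_derivable q Kx.
Qed.

Lemma powR_fundamental_continuous (q : R) x : D x -> {for x, continuous (fun z => G z `^ q)}.
Proof.
move=> Dx; apply: (@continuous_comp _ _ _ G (@powR R ^~ q)).
  by have [cG _] := fundamental_C1; exact: cG.
exact/powR_continuous/punctured_subset.
Qed.

Lemma powR_fundamental_C1 (q : R) : C1 X D (@powR R ^~ q \o G).
Proof.
apply: (C1_comp (dphi := fun s => q * s `^ (q - 1))).
- exact: open_punctured.
- exact: fundamental_C1.
- by move=> x /punctured_subset; exact: powR_derivable.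
- move=> x /punctured_subset Kx; apply: cvgM; first exact: cvg_cst.
  exact: powR_continuous.
Qed.

Lemma powR_fundamental_within (q : R) : {within K, continuous (@powR R ^~ q \o G)}.
Proof.
apply: within_continuous_comp fundamental_within _ => x Kx.
exact: powR_continuous.
Qed.

Lemma Xd_powR_fundamental (q : R) k x : D x ->
  Xd (X k) (@powR R ^~ q \o G) x = q * G x `^ (q - 1) * Xd (X k) G x.
Proof.
move=> Dx; apply: is_Xd_val; apply: is_Xd_comp.
  exact: C1_is_Xd fundamental_C1 Dx.
exact/powR_derivable/punctured_subset.
Qed.

Lemma sqgrad_ge0 f x : 0 <= sqgrad X f x.
Proof. by apply: sumr_ge0 => k _; exact: sqr_ge0. Qed.

(* Test the divergence formula with [v = G^q * cutoff (G / n)]. As [q < 0], both terms of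
   [dv = (q G^(q-1) cutoff + G^q dcutoff / n) dG] have the same sign, so that the bounded
   boundary term controls [G^(q-1) |dG|^2 cutoff]; then let [n] go to infinity. *)
Lemma powR_sqgrad_integrable (q : R) : q < 0 -> intD (fun x => G x `^ (q - 1) * sqgrad X G x).
Proof.
move=> q0; pose w x := G x `^ (q - 1) * sqgrad X G x.
have w0 x : 0 <= w x by rewrite mulr_ge0 ?powR_ge0 ?sqgrad_ge0.
have cw x : D x -> {for x, continuous w}.
  by move=> Dx; apply: cvgM; [exact: powR_fundamental_continuous|exact: sqgrad_continuous].
have mw : measD w by exact: measC.
have mcut n : measD (cut n) by apply: measC => x; exact: continuous_cut.
have mdcut n : measD (dcut n) by apply: measC => x; exact: continuous_dcut.
have cut0 n x : 0 <= cut n x := cutoff_ge0 _.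
have q0' : 0 <= - q by rewrite oppr_ge0 ltW.
have [n0 hn0] := strong_divergence_cut.
pose h := @powR R ^~ q \o G.
pose c := int_form B (scale_form h (grad_form X nu Om G)).
(* For a fixed [n] the integrand vanishes near the pole and is bounded elsewhere, on a set of finite
   volume. *)
have Fi n : intD (fun x => cut n x * (q * w x) + dcut n x * w x).
  have [U [oU Uy UG]] := near_pole_cut n.
  have [C1 hC1] := fundamental_grad_bounded oU Uy.
  have [C2 hC2] := bounded_off_pole oU Uy (@powR_fundamental_within (q - 1)).
  apply: (@bounded_integrable_borel _ _ _ _ _ ((`|q| + 8) * `|C2 * C1|)) => //.
  - apply: measurable_funD; apply: measurable_funM; [exact: mcut| |exact: mdcut|exact: mw].
    by apply: measurable_funM; [exact: measurable_cst|exact: mw].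
  - exact: volume_punctured.
  - move=> x Dx; have cOx : closure Om x by have [] := punctured_subset Dx.
    have [Ux|Ux] := pselect (U x).
      have [-> ->] := UG x Ux Dx.2; rewrite !mul0r addr0 normr0.
      by rewrite mulr_ge0// addr_ge0.
    have wC : w x <= `|C2 * C1|.
      rewrite (le_trans _ (ler_norm _))//.
      apply: ler_pM; rewrite ?powR_ge0 ?sqgrad_ge0 ?hC1//.
      by rewrite (le_trans _ (hC2 _ cOx Ux))// ler_norm.
    apply: (le_trans (cutDcut _ _ _ _)); rewrite normrM (ger0_norm (w0 x)) -mulrDl.
    by apply: ler_wpM2l wC; rewrite addr_ge0.
have Pe n x : D x -> cut n x * (q * w x) + dcut n x * w x =
    cut n x * (\sum_k Xd (X k) h x * Xd (X k) G x) +
      dcut n x * (h x / G x * sqgrad X G x).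
  move=> Dx; have G0 := fundamental_gt0 (punctured_subset Dx).
  have -> : \sum_k Xd (X k) h x * Xd (X k) G x = q * w x.
    rewrite /w /sqgrad !mulr_sumr; apply: eq_bigr => k _.
    by rewrite Xd_powR_fundamental//; ring.
  rewrite /w /h/= powRB; last by rewrite (gt_eqF G0)// implybT.
  by rewrite powRr1// ltW.
have Fc n : (n0 <= n)%N ->
    \int[mu]_(x in (D : set (borel M))) (cut n x * (q * w x) + dcut n x * w x) = c.
  move=> n0n; rewrite /c -(hn0 n h)//.
  - by apply: eq_Rintegral => x; rewrite inE; exact: Pe.
  - exact: powR_fundamental_C1.
  - exact: powR_fundamental_within.
  - by apply: eq_integrable (Fi n) => // x; rewrite inE /= => Dx; rewrite Pe.
have leF n : (n0 <= n)%N ->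
    (\int[mu]_(x in (D : set (borel M))) (- q * (cut n x * w x))%:E <= (- c)%:E)%E.
  move=> n0n.
  have -> : (- c)%:E = (\int[mu]_(x in (D : set (borel M)))
      (- (cut n x * (q * w x) + dcut n x * w x))%:E)%E.
    rewrite -(Fc n n0n) EFinN fineK; last exact: (integrable_fin_num mD (Fi n)).
    by have := integralZl mD (Fi n) (-1); under eq_integral do rewrite -EFinM mulN1r;
      rewrite mulN1e => ->.
  apply: ge0_le_integral => //.
  - move=> x Dx; by rewrite lee_fin; apply: mulr_ge0 => //; exact: mulr_ge0.
  - apply/measurable_EFinP; apply: measurable_funM; first exact: measurable_cst.
    by apply: measurable_funM; [exact: mcut|exact: mw].
  - by have /integrableN/integrableP[] := Fi n.
  - move=> x Dx; rewrite lee_fin.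
    have : dcut n x <= 0.
      rewrite mulr_ge0_le0 ?dcutoff_le0// divr_ge0 ?ler0n// ltW// fundamental_gt0//.
      exact: punctured_subset.
    have := w0 x; have := cut0 n x.
    move: (cut n x) (dcut n x) (w x) => a b v *; nra.
(* The shift by [n0] skips the indices for which the cutoff may still be felt on the boundary. *)
have := @fatou _ (borel M) R mu D mD (fun n x => (- q * (cut (n + n0) x * w x))%:E).
have -> : (\int[mu]_(x in (D : set (borel M))) limn_einf (fun n => (- q * (cut (n + n0) x * w x))%:E) =
    \int[mu]_(x in (D : set (borel M))) (- q * w x)%:E)%E.
  apply: eq_integral => x; rewrite inE => Dx.
  suff /cvg_limn_einf_sup[->] :
    (- q * (cut (n + n0) x * w x))%:E @[n --> \oo] --> (- q * w x)%:E by [].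
  apply: cvg_near_cst; have [k _ hk] := cut_near Dx; exists k => // n /= kn.
  by have [->] := hk (n + n0)%N (leq_trans kn (leq_addr _ _)); rewrite mul1r.
move=> F; have wi : intD (fun x => - q * w x).
  apply/integrableP; split; first by apply/measurable_EFinP; apply: measurable_funM.
  have -> : (\int[mu]_(x in (D : set (borel M))) `|(- q * w x)%:E| =
      \int[mu]_(x in (D : set (borel M))) (- q * w x)%:E)%E.
    by apply: eq_integral => x _; rewrite gee0_abs// lee_fin mulr_ge0.
  apply: le_lt_trans (F _ _) _.
  - move=> n; apply/measurable_EFinP; apply: measurable_funM => //.
    by apply: measurable_funM; [exact: mcut|exact: mw].
  - move=> n x _; rewrite lee_fin; apply: mulr_ge0 => //; exact: mulr_ge0.
  - apply: (@le_lt_trans _ _ (- c)%:E); last exact: ltry.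
    rewrite limn_einf_lim; apply: lime_le; first exact: is_cvg_einfs.
    apply: nearW => n; apply: le_trans (leF (n + n0)%N (leq_addl _ _)).
    by apply: ereal_inf_lbound; exists n => /=.
have := integrableZ_borel (- q)^-1 mD wi.
apply: eq_integrable => // x _ /=; congr EFin.
by rewrite mulKf// oppr_eq0 lt_eqF.
Qed.

End pole.

(** * Weighted integrals *)

Section weighted_integrals.
Context {R : realType} {M : ptopologicalType} {m : nat} {A : manifold R M m.+1}.
Context {nu : volume_form A} {mu : {measure set (borel M) -> \bar R}}.
Context {N : nat} {X : 'I_N -> vector_field A}.
Context {y : M} {T : set M} {G : M -> R} {Om : set M} {B : cells (A := A) (boundary Om)}.
Hypothesis hmu : is_volume_measure nu mu.
Hypothesis hA : assumption_Aplus X nu mu y T G.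
Hypothesis hy : ~ boundary Om y.
Hypothesis hOm : strongly_admissible X nu mu y T G B.

Let D : set M := Om `\ y.
Let K : set M := closure Om `\ y.
Let intD (f : M -> R) := mu.-integrable (D : set (borel M)) (EFin \o (f : borel M -> R)).
Let measD (f : M -> R) := measurable_fun (D : set (borel M)) (f : borel M -> R).

Let oOm : open Om. Proof. by case: hOm => -[[]]. Qed.
Let cOm : compact (closure Om). Proof. by case: hOm => -[[]]. Qed.
Let DK : D `<=` K. Proof. exact: punctured_subset. Qed.
Let oD : open D. Proof. exact: open_punctured hOm. Qed.
Let mD : measurable (D : set (borel M)). Proof. exact: open_measurable_borel. Qed.
Let measC (f : M -> R) : (forall x, D x -> {for x, continuous f}) -> measD f.
Proof. by move=> cf; exact: continuous_measurable_borel. Qed.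
Let G0 x : K x -> 0 < G x. Proof. exact: (fundamental_gt0 hA hOm). Qed.
Let cG x : D x -> {for x, continuous G}.
Proof. by have [+ _] := fundamental_C1 hOm; apply. Qed.

Lemma powR_pred (s q : R) : 0 < s -> s `^ (q - 1) = s `^ q / s.
Proof. by move=> s0; rewrite powRB ?(gt_eqF s0) ?implybT// powRr1// ltW. Qed.

(** Near the pole integrability belongs to the notion of distributional solution, on compact subsets
    of [T]; elsewhere [G] is bounded and the volume finite. *)
Lemma fundamental_integrable : intD G.
Proof.
have mG : measD G by exact: measC.
have [U [V [oU Uy [cV VT UV]]]] : exists U V : set M,
    [/\ open U, U y & [/\ compact V, V `<=` T & Om `&` U `<=` V]].
  (* If [y] is in [Om], it has a compact neighbourhood inside [Om], hence inside [T]. Otherwise [y],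
     being off the boundary, is outside [closure Om], and the empty compact set will do. *)
  have [Oy|nOy] := pselect (Om y).
    have nOm : nbhs y Om by exact: open_nbhs_nbhs.
    have /(_ Om nOm)[V nV VOm] : {for y, @regular_space M}.
      apply: (compact_regular (manifold_hausdorff A) cOm).
      by apply: filterS nOm; exact: subset_closure.
    exists V^°, (closure V); split => //; first exact: open_interior.
    split.
    - apply: (subclosed_compact _ cOm); first exact: closed_closure.
      by apply: subset_trans VOm _; exact: subset_closure.
    - by apply: subset_trans VOm _; have [] := hOm.
    - by move=> x [_ /interior_subset Vx]; exact: subset_closure.
  exists (~` closure Om), set0; split => //.
  - by rewrite openC; exact: closed_closure.
  - by move=> cy; apply: hy; split => // /interior_subset.
  - split => //; first exact: compact0.
    by move=> x [Ox]; apply; exact: subset_closure.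
have [C hC] := bounded_off_pole hOm oU Uy (fundamental_within hOm).
have [[_ _ _ [/(_ V cV VT) iV _]] _ _] := hA.
have mV : measurable (V : set (borel M)).
  rewrite -[X in measurable X]setCK; apply: measurableC; apply: open_measurable_borel.
  by rewrite openC; apply: compact_closed => //; exact: (manifold_hausdorff A).
have iV' : intD ((fun x => `|G x|) \_ V).
  have := integrable_norm_borel iV; rewrite integrable_mkcond// restrict_EFin => i.
  by apply: (integrableS _ _ _ i).
apply: (@dominated_integrable_borel _ _ _ _ _ (fun x => ((fun x => `|G x|) \_ V) x + `|C|)) => //.
  move=> x [Ox xy]; rewrite patchE; case: ifPn => xV; first by rewrite lerDl.
  rewrite add0r (le_trans _ (ler_norm _))//; apply: hC; first exact: subset_closure.
  by move=> Ux; move/negP : xV; apply; rewrite inE; apply: UV.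
apply: integrableD_borel => //.
apply: (@bounded_integrable_borel _ _ _ _ _ `|C|) => //.
  exact: (volume_punctured hmu hOm).
by move=> x _; rewrite normr_id.
Qed.

(** With [c] a positive lower bound of [G], the bound [G^q <= 1 + c^q + G] holds: the term [G] takes
    care of [G >= 1], and for [G < 1] the term 1 or [c^q] does, according to the sign of [q]. *)
Lemma powR_integrable (q : R) : q < 1 -> intD (fun x => G x `^ q).
Proof.
move=> q1; have [c c0 hc] := fundamental_lbound hA hOm.
apply: (@dominated_integrable_borel _ _ _ _ _ (fun x => (1 + c `^ q) + G x)) => //.
- by apply: measC => x; exact: (powR_fundamental_continuous hA hOm).
- move=> x Dx; have Gx := G0 (DK Dx); have cx := hc _ (DK Dx).
  rewrite ger0_norm ?powR_ge0//.
  have [G1|G1] := leP 1 (G x).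
    by rewrite (le_trans (ler1_powR G1 (ltW q1)))// lerDr addr_ge0// powR_ge0.
  have [q0|q0] := leP 0 q.
    apply: (@le_trans _ _ 1); last by rewrite -addrA lerDl addr_ge0 ?powR_ge0// ltW.
    by rewrite -(powRr0 (G x)); apply: ger_powR q0; rewrite Gx ltW.
  apply: (@le_trans _ _ (c `^ q)); last first.
    by rewrite addrAC lerDr addr_ge0// ltW.
  rewrite -[q]opprK 2!(powRN _ (- q)) lef_pV2 ?posrE ?powR_gt0//.
  by apply: ge0_ler_powR => //; rewrite ?nnegrE ?oppr_ge0; exact: ltW.
- apply: integrableD_borel => //; last exact: fundamental_integrable.
  apply: (@bounded_integrable_borel _ _ _ _ _ `|1 + c `^ q|) => //.
  exact: (volume_punctured hmu hOm).
Qed.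

Context {u : M -> R} {p : R}.
Hypothesis hu2 : C2 X Om u.
Hypothesis hu1 : C1_upto X Om (closure Om) u.
Hypothesis p1 : p < 1.

Lemma C1_punctured (f : M -> R) : C1 X Om f -> C1 X D f.
Proof.
move=> [cf df]; split => [x [Ox _]|k]; first exact: cf.
by have [h1 h2] := df k; split => x [Ox _]; [exact: h1|exact: h2].
Qed.

Let cu : C1 X D u. Proof. by apply: C1_punctured; case: hu2. Qed.
Let cdu k : C1 X D (Xd (X k) u). Proof. by apply: C1_punctured; case: hu2. Qed.

Let wu : {within closure Om, continuous u}. Proof. by case: hu1. Qed.

Let within_K (f : M -> R) : {within closure Om, continuous f} -> {within K, continuous f}.
Proof. by apply: continuous_subspaceW => x []. Qed.

Let bounded_closure (f : M -> R) : {within closure Om, continuous f} ->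
  exists C, forall x, closure Om x -> `|f x| <= C.
Proof.
move=> cf; have [|C hC] := @bounded_compactD _ _ _ set0 f cOm open0; first by rewrite setD0.
by exists C => x cx; apply: hC => //.
Qed.

Lemma energy_integrable : intD (fun x => G x `^ p * sqgrad X u x).
Proof.
have [_ _ gu] := hu1.
have /choice[C hC] : forall k : 'I_N, exists C, forall x, D x -> `|Xd (X k) u x| <= C.
  move=> k; have [g cg eg] := gu k; have [C hC] := bounded_closure cg.
  exists C => x [Ox xy]; rewrite -eg//; apply: hC; exact: subset_closure.
have cs x : D x -> {for x, continuous (sqgrad X u)}.
  move=> Dx; have [_ /all_and2[_ cdk]] := cu.
  by apply: cvg_sum_ord => k; under eq_fun do rewrite expr2; apply: cvgM; exact: cdk.
pose C' := \sum_k C k ^+ 2.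
apply: (@dominated_integrable_borel _ _ _ _ _ (fun x => C' * G x `^ p)) => //.
- apply: measC => x Dx; apply: cvgM; last exact: cs.
  exact: (powR_fundamental_continuous hA hOm).
- move=> x Dx; rewrite ger0_norm ?mulr_ge0 ?powR_ge0 ?sqgrad_ge0// mulrC.
  apply: ler_wpM2r; first exact: powR_ge0.
  apply: ler_sum => k _; rewrite -real_normK ?num_real//.
  by rewrite lerXn2r ?nnegrE ?hC// (le_trans _ (hC k x Dx)).
- by apply: integrableZ_borel => //; exact: powR_integrable.
Qed.

(** Since [u] is bounded, this reduces to [G^(p-2) |dG|^2], the case [q = p - 1 < 0] of
    [powR_sqgrad_integrable]. The same integrand also dominates cutoff errors. *)
Lemma hardy_integrable : intD (fun x => G x `^ p * (sqgrad X G x / G x ^+ 2) * u x ^+ 2).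
Proof.
have [C hC] := bounded_closure wu.
have q0 : p - 1 < 0 by rewrite subr_lt0.
have := integrableZ_borel (C ^+ 2) mD (powR_sqgrad_integrable hmu hA hy hOm q0).
apply: dominated_integrable_borel => //.
- have [cu0 _] := cu.
  apply: measC => x Dx; apply: cvgM; last first.
    under eq_fun do rewrite expr2; rewrite expr2; apply: cvgM; exact: cu0.
  apply: cvgM; first exact: (powR_fundamental_continuous hA hOm).
  apply: cvgM; first exact: (sqgrad_continuous hOm).
  apply: cvgV; first by rewrite expf_neq0// gt_eqF// G0//; exact: DK.
  by under eq_fun do rewrite expr2; rewrite expr2; apply: cvgM; exact: cG.
- move=> x Dx; have Gx := G0 (DK Dx).
  rewrite ger0_norm; last first.
    apply: mulr_ge0; last exact: sqr_ge0.
    by apply: mulr_ge0; rewrite ?powR_ge0// divr_ge0 ?sqr_ge0 ?sqgrad_ge0.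
  rewrite mulrC (_ : G x `^ p * _ = G x `^ (p - 1 - 1) * sqgrad X G x); last first.
    by rewrite !powR_pred//; field; rewrite gt_eqF.
  apply: ler_wpM2r; first by rewrite mulr_ge0 ?powR_ge0 ?sqgrad_ge0.
  rewrite -real_normK ?num_real// lerXn2r ?nnegrE//; last first.
    by apply: hC; apply: subset_closure; case: Dx.
  by rewrite (le_trans _ (hC x _))//; apply: subset_closure; case: Dx.
Qed.

Let gdot x := \sum_k Xd (X k) u x * Xd (X k) G x.

Let cgdot x : D x -> {for x, continuous gdot}.
Proof.
move=> Dx; have [_ /all_and2[_ cdk]] := cu; have [_ /all_and2[_ cGk]] := fundamental_C1 hOm.
by apply: cvg_sum_ord => k; apply: cvgM; [exact: cdk|exact: cGk].
Qed.

(** Termwise [|a b| <= a^2 + b^2]; the constant is crude because only integrability is at stake. *)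
Lemma gdot_le x : D x -> `|u x * (gdot x / G x)| <=
  sqgrad X u x + sqgrad X G x / G x ^+ 2 * u x ^+ 2.
Proof.
move=> Dx; have Gx := G0 (DK Dx).
rewrite /gdot /sqgrad !mulr_suml mulr_sumr -big_split/=.
apply: (le_trans (ler_norm_sum _ _ _)); apply: ler_sum => k _.
have -> : u x * (Xd (X k) u x * Xd (X k) G x / G x) =
  Xd (X k) u x * (u x * Xd (X k) G x / G x) by ring.
have -> : Xd (X k) G x ^+ 2 / G x ^+ 2 * u x ^+ 2 = (u x * Xd (X k) G x / G x) ^+ 2.
  by field; rewrite gt_eqF.
move: (Xd (X k) u x) (u x * _ / _) => a b.
by rewrite ler_norml; apply/andP; split; nra.
Qed.

(** The growth [phi = O(G^(p-1))], [phi' = O(G^(p-2))] is chosen so that every term is dominated by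
    the energy and Hardy integrands. It serves for [s^(p-1)] with and without the factor [ell]. *)
Lemma weighted_divergence (phi dphi : R -> R) (C : R) :
  (forall x, K x -> is_derive (G x) 1 phi (dphi (G x))) ->
  (forall x, K x -> {for G x, continuous dphi}) ->
  (forall x, D x -> `|phi (G x)| <= C * (G x `^ p / G x)) ->
  (forall x, D x -> `|dphi (G x)| <= C * (G x `^ p / G x ^+ 2)) ->
  let I x := 2 * u x * phi (G x) * gdot x + u x ^+ 2 * dphi (G x) * sqgrad X G x in
  intD I /\ \int[mu]_(x in (D : set (borel M))) I x =
    int_form B (scale_form (fun x => u x ^+ 2 * phi (G x)) (grad_form X nu Om G)).
Proof.
move=> dp cdp leC ledC I.
pose h := fun x => (u x * u x) * (phi \o G) x.
have cphi x : K x -> {for G x, continuous phi}.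
  by move=> Kx; apply/differentiable_continuous/derivable1_diffP; have [] := dp x Kx.
have c1 : C1 X D (phi \o G).
  by apply: (C1_comp (dphi := dphi)) (fundamental_C1 hOm) _ _ => // x /DK; [exact: dp|exact: cdp].
have c2 : C1 X D (fun x => u x * u x) by exact: C1M.
have wh : {within K, continuous h}.
  apply: within_continuousM; first by apply: within_continuousM; exact: within_K.
  exact: within_continuous_comp (fundamental_within hOm) cphi.
have Xh k x : D x -> Xd (X k) h x =
    2 * u x * phi (G x) * Xd (X k) u x + u x ^+ 2 * dphi (G x) * Xd (X k) G x.
  move=> Dx; have d1 := C1_is_Xd k cu Dx.
  have d2 := is_Xd_comp (C1_is_Xd k (fundamental_C1 hOm) Dx) (dp x (DK Dx)).
  by rewrite (is_Xd_val (is_XdM (is_XdM d1 d1) d2)) /=; ring.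
have Ih x : D x -> I x = \sum_k Xd (X k) h x * Xd (X k) G x.
  move=> Dx; rewrite /I /gdot /sqgrad !mulr_sumr -big_split/=; apply: eq_bigr => k _.
  by rewrite Xh//; ring.
have cu0 : forall x, D x -> {for x, continuous u} by have [] := cu.
have cu2 x : D x -> {for x, continuous (fun z => u z ^+ 2)}.
  move=> Dx; apply: (@continuous_comp _ _ _ u (fun s => s ^+ 2)); first exact: cu0.
  exact: exprn_continuous.
have cphiG x : D x -> {for x, continuous (fun z => phi (G z))}.
  by move=> Dx; apply: (@continuous_comp _ _ _ G phi); [exact: cG|exact/cphi/DK].
have cdphiG x : D x -> {for x, continuous (fun z => dphi (G z))}.
  by move=> Dx; apply: (@continuous_comp _ _ _ G dphi); [exact: cG|exact/cdp/DK].
pose E x := G x `^ p * sqgrad X u x.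
pose H x := G x `^ p * (sqgrad X G x / G x ^+ 2) * u x ^+ 2.
have iE : intD E := energy_integrable.
have iH : intD H := hardy_integrable.
have iI : intD I.
  (* The cross term contributes [2 C (E + H)], the term in [dphi] contributes [C H]. *)
  apply: (@dominated_integrable_borel _ _ _ _ _ (fun x => (2 * C) * E x + (3 * C) * H x)) => //.
  - apply: measC => x Dx; apply: cvgD; apply: cvgM.
    + apply: cvgM; last exact: cphiG.
      by apply: cvgM; [exact: cvg_cst|exact: cu0].
    + exact: cgdot.
    + by apply: cvgM; [exact: cu2|exact: cdphiG].
    + exact: (sqgrad_continuous hOm).
  - move=> x Dx; have Gx := G0 (DK Dx); have gd := gdot_le Dx.
    have S0 := sqgrad_ge0 (X := X) G x.
    have Gp : 0 < G x `^ p by rewrite powR_gt0.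
    have e1 : `|2 * u x * phi (G x) * gdot x| <= 2 * C * (E x + H x).
      rewrite (_ : 2 * u x * phi (G x) * gdot x = 2 * (phi (G x) * G x * (u x * (gdot x / G x)))); last first.
        by field; rewrite gt_eqF.
      rewrite normrM (ger0_norm (ler0n _ _)) -[leRHS]mulrA ler_pM2l// normrM.
      apply: (@le_trans _ _ ((C * G x `^ p) * `|u x * (gdot x / G x)|)).
        apply: ler_wpM2r => //; rewrite normrM (gtr0_norm Gx) -ler_pdivlMr//.
        by rewrite -mulrA; exact: leC.
      rewrite -mulrA /E /H -mulrA -mulrDr.
      have C0 : 0 <= C.
        by rewrite -(pmulr_lge0 _ (divr_gt0 Gp Gx)) (le_trans _ (leC x Dx)).
      by rewrite ler_wpM2l// ler_pM2l.
    have e2 : `|u x ^+ 2 * dphi (G x) * sqgrad X G x| <= C * H x.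
      rewrite (normrM _ (sqgrad X G x)) (normrM (u x ^+ 2)) (ger0_norm S0) (ger0_norm (sqr_ge0 _)) /H.
      rewrite (_ : C * _ = u x ^+ 2 * (C * (G x `^ p / G x ^+ 2)) * sqgrad X G x); last by ring.
      by apply: ler_wpM2r => //; apply: ler_wpM2l; [exact: sqr_ge0|exact: ledC].
    apply: (le_trans (ler_normD _ _)); apply: (le_trans (lerD e1 e2)).
    by rewrite le_eqVlt; apply/orP; left; apply/eqP; ring.
  - by apply: integrableD_borel => //; apply: integrableZ_borel.
split => //.
transitivity (int_form B (scale_form h (grad_form X nu Om G))); last first.
  by apply: eq_int_form => x W _; rewrite /scale_form /h/= expr2.
apply: etrans (strong_divergence hmu hA hy hOm (h := h) _ _ _ _).
- by apply: eq_Rintegral => x; rewrite inE; exact: Ih.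
- exact: C1M oD c2 c1.
- exact: wh.
- by apply: eq_integrable iI => // x; rewrite inE => Dx /=; rewrite Ih.
(* The error term of the cutoff, [h / G] times [|dG|^2], is again at most [C H]. *)
- apply: (@dominated_integrable_borel _ _ _ _ _ (fun x => C * H x)) => //.
  + apply: measC => x Dx; apply: cvgM; last exact: (sqgrad_continuous hOm).
    apply: cvgM; last by apply: cvgV; [rewrite gt_eqF// G0//; exact: DK|exact: cG].
    by apply: cvgM; [apply: cvgM; exact: cu0|exact: cphiG].
  + move=> x Dx; have Gx := G0 (DK Dx); have S0 := sqgrad_ge0 (X := X) G x.
    rewrite normrM (ger0_norm S0) normrM (ger0_norm (_ : 0 <= (G x)^-1)); last first.
      by rewrite invr_ge0 ltW.
    rewrite /h/= -expr2 normrM (ger0_norm (sqr_ge0 _)) /H.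
    rewrite (_ : C * _ = u x ^+ 2 * (C * (G x `^ p / G x)) / G x * sqgrad X G x); last first.
      by field; rewrite gt_eqF.
    apply: ler_wpM2r => //; apply: ler_wpM2r; first by rewrite invr_ge0 ltW.
    by apply: ler_wpM2l; [exact: sqr_ge0|exact: leC].
  + exact: integrableZ_borel.
Qed.

(** [L u] is merely continuous in [Om], so the integrability of its term is a premise, to be met
    when the left-hand side is finite. *)
Lemma flux_divergence : intD (fun x => G x `^ p * (u x * sublaplacian X u x)) ->
  let I x := G x `^ p * sqgrad X u x + G x `^ p * (u x * sublaplacian X u x)
    + p * (G x `^ p * (u x * (gdot x / G x))) in
  intD I /\ \int[mu]_(x in (D : set (borel M))) I x =
    int_form B (scale_form (fun x => G x `^ p * u x) (grad_form X nu Om u)).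
Proof.
move=> iL I.
have cu0 : forall x, D x -> {for x, continuous u} by have [] := cu.
have iQ : intD (fun x => G x `^ p * (u x * (gdot x / G x))).
  apply: (@dominated_integrable_borel _ _ _ _ _ (fun x => G x `^ p * sqgrad X u x +
      G x `^ p * (sqgrad X G x / G x ^+ 2) * u x ^+ 2)) => //.
  - apply: measC => x Dx; apply: cvgM; first exact: (powR_fundamental_continuous hA hOm).
    apply: cvgM; first exact: cu0.
    apply: cvgM; first exact: cgdot.
    by apply: cvgV; [rewrite gt_eqF// G0//; exact: DK|exact: cG].
  - move=> x Dx; rewrite normrM (ger0_norm (powR_ge0 _ _)) -mulrA -mulrDr.
    by apply: ler_wpM2l; [exact: powR_ge0|exact: gdot_le].
  - by apply: integrableD_borel => //; [exact: energy_integrable|exact: hardy_integrable].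
have iI : intD I.
  apply: integrableD_borel => //; last exact: integrableZ_borel.
  by apply: integrableD_borel => //; exact: energy_integrable.
split => //; have [_ _ gu] := hu1.
have /choice[g hg] : forall k, exists g : M -> R, {within closure Om, continuous g} /\
    forall x, Om x -> g x = Xd (X k) u x.
  by move=> k; have [g] := gu k; exists g.
(* [f] contains the derivatives of [u] and [h] their continuous extensions: C^1 regularity is
   obtained from [f], continuity up to the boundary from [h]. *)
pose f k x := (@powR R ^~ p \o G) x * u x * Xd (X k) u x.
pose h k x := (@powR R ^~ p \o G) x * u x * g k x.
have fh k : {in D, f k =1 h k}.
  by move=> x; rewrite inE => -[Ox _]; rewrite /f /h; have [_ ->] := hg k.
have cf k : C1 X D (f k).
  exact: C1M oD (C1M oD (powR_fundamental_C1 hA hOm p) cu) (cdu k).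
have Xh k x : D x -> Xd (X k) (h k) x = G x `^ p * (Xd (X k) u x ^+ 2) +
    G x `^ p * (u x * Xd (X k) (Xd (X k) u) x) +
    p * (G x `^ p * (u x * (Xd (X k) u x * Xd (X k) G x / G x))).
  move=> Dx; rewrite -(@near_eq_Xd _ _ _ _ (X k) (f k)); last first.
    by apply: filterS (open_nbhs_nbhs (conj oD Dx)) => z Dz; apply: fh; rewrite inE.
  have d1 := is_Xd_comp (C1_is_Xd k (fundamental_C1 hOm) Dx) (powR_derivable hA hOm p (DK Dx)).
  have d2 := C1_is_Xd k cu Dx; have d3 := C1_is_Xd k (cdu k) Dx.
  rewrite (is_Xd_val (is_XdM (is_XdM d1 d2) d3)) /= powR_pred ?G0//; last exact: DK.
  by ring.
have Ih x : D x -> I x = \sum_k Xd (X k) (h k) x.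
  move=> Dx; rewrite /I /sqgrad /sublaplacian /gdot mulr_suml !mulr_sumr -!big_split/=.
  by apply: eq_bigr => k _; rewrite Xh.
transitivity (int_form B (flux_form X nu h)); last first.
  apply: eq_int_form => x W bx; rewrite /scale_form /grad_form /flux_form mulr_sumr.
  apply: eq_bigr => k _; rewrite /h/= -!mulrA; congr (_ * (_ * (_ * _))).
  have [wg eg] := hg k; have cx : closure Om x by case: bx.
  have pf : ProperFilter (within Om (nbhs x)) by exact: within_nbhs_proper.
  (* [ext] is a limit along [Om], where [g k] and [Xd (X k) u] coincide, so continuity of [g k]
     identifies it. *)
  apply/esym; apply: cvg_lim => //.
  have /subspace_continuousP/(_ x cx) := wg.
  change (g k @ within (closure Om) (nbhs x) --> g k x -> Xd (X k) u @ within Om (nbhs x) --> g k x).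
  move=> cg; apply: cvg_trans (_ : g k @ within Om (nbhs x) --> _).
    by apply: near_eq_cvg; rewrite near_withinE; apply: nearW => z Oz; exact: eg.
  apply: cvg_trans cg; apply: cvg_app; apply: within_subset; exact: subset_closure.
apply: etrans (divergence_flux hmu hA hy hOm (h := h) _ _ _ _).
- by apply: eq_Rintegral => x; rewrite inE; exact: Ih.
- by move=> k; exact: eq_C1 oD (fh k) (cf k).
- move=> k; apply: within_continuousM; last by apply: within_K; have [] := hg k.
  apply: within_continuousM; last exact: within_K.
  exact: (powR_fundamental_within hA hOm).
- by apply: eq_integrable iI => // x; rewrite inE => Dx /=; rewrite Ih.
- apply: eq_integrable iQ => // x; rewrite inE => Dx /=; congr EFin.
  rewrite /gdot mulr_suml !mulr_sumr; apply: eq_bigr => k _.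
  rewrite -fh ?inE// /f/=; ring.
Qed.

End weighted_integrals.

(** * The Rellich inequality *)

Lemma measurable_fun_inve d (T : measurableType d) (R : realType) (D : set T) (f : T -> R) :
  measurable D -> (forall x, D x -> 0 <= f x) -> measurable_fun D f ->
  measurable_fun D (fun x => ((f x)%:E^-1)%E).
Proof.
move=> mD f0 mf.
(* The extended inverse of 0 is [+oo]; elsewhere the inverse is a real power. *)
apply: (eq_measurable_fun (fun x => if f x == 0 then +oo%E else (f x `^ (-1))%:E)).
  move=> x; rewrite inE => Dx; rewrite inver; case: ifP => // _.
  by rewrite powR_inv1// f0.
apply: measurable_fun_if => //.
- by apply: measurable_fun_eqr => //; exact: measurable_cst.
- apply: measurable_funS mD _ _ => //.
  by apply/measurable_EFinP; exact: (measurableT_comp (@measurable_powR R (-1)) mf).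
Qed.

(** For [S > 0] the difference of the two sides is [w / S] times a square. For [S = 0] the
    right-hand side is [+oo] unless [l = 0], in which case both sides are 0. *)
Lemma rellich_young (R : realType) (a b c w g gam u l S : R) :
  0 < b -> 0 < w -> 0 < g -> 0 < gam -> 0 <= S -> a = gam ^+ 2 * w * g ^+ 2 * b ->
  ((- c * (w * (u * l)) - (c / 2) ^+ 2 / gam ^+ 2 * (w * (S / g ^+ 2) * u ^+ 2))%:E <=
    (a * l ^+ 2)%:E / (b * S)%:E)%E.
Proof.
move=> b0 w0 g0 gam0; rewrite le_eqVlt => /predU1P[<-|S0] ae.
  rewrite mulr0 inve0 mul0r mulr0 mul0r mulr0 subr0.
  have [->|l0] := eqVneq l 0; first by rewrite !mulr0 expr0n/= mulr0 mul0e.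
  rewrite gt0_muley ?leey// lte_fin ae.
  by rewrite mulr_gt0 ?exprn_even_gt0// !mulr_gt0 ?exprn_gt0.
rewrite inver mulf_eq0 (gt_eqF b0) (gt_eqF S0)/= -EFinM lee_fin -subr_ge0.
rewrite (_ : _ - _ = w / S * (gam * g * l + c / 2 * S * u / (gam * g)) ^+ 2).
  by rewrite mulr_ge0 ?sqr_ge0// ltW// divr_gt0.
by rewrite ae; field; rewrite !gt_eqF.
Qed.

(* After the weight is divided out, the right-hand side is minus a multiple of
   [|a - u (lam + ell / 2) / gam * (b / g)|^2], up to the two terms absorbed by Young. *)
Lemma rellich_identity (R : realType) (n : nat) (a b : 'I_n -> R) (w g gam lam del ell u l p : R) :
  g != 0 -> gam != 0 -> p = 1 - 2 * lam / gam -> del = 2 * (gam - lam) ->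
  let W := \sum_k a k ^+ 2 in let S := \sum_k b k ^+ 2 in let P := \sum_k a k * b k in
  let kap := (4 * lam - del) * del in
  let Ia := 2 * u * (w / g) * P + u ^+ 2 * ((p - 1) * (w / g ^+ 2)) * S in
  let Ib := 2 * u * (w / g * ell) * P +
    u ^+ 2 * ((p - 1) * (w / g ^+ 2) * ell - w / g ^+ 2 * ell ^+ 2 / gam) * S in
  let Ic := w * W + w * (u * l) + p * (w * (u * (P / g))) in
  del ^+ 2 / 4 * (w * W) + kap / 16 * (gam ^- 2 * (w * (S / g ^+ 2) * u ^+ 2) * ell ^+ 2)
    + kap / (8 * gam) * Ib + kap * (2 * lam) / (8 * gam) * Ia
    + 2 * lam * del / 4 * (p * Ia - 2 * Ic) =
  - (lam * del) * (w * (u * l)) - (lam * del / 2) ^+ 2 / gam ^+ 2 * (w * (S / g ^+ 2) * u ^+ 2)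
    - kap / 4 * (w * \sum_k (a k - u * (lam + ell / 2) / (gam * g) * b k) ^+ 2).
Proof.
move=> g0 gam0 -> -> W S P kap Ia Ib Ic.
set c := u * (lam + ell / 2) / (gam * g).
have -> : \sum_k (a k - c * b k) ^+ 2 = W - 2 * c * P + c ^+ 2 * S.
  rewrite /W /P /S !mulr_sumr -sumrB -big_split/=; apply: eq_bigr => k _; ring.
rewrite /kap /Ia /Ib /Ic /c {kap Ia Ib Ic c}; move: W S P => W S P.
by field; rewrite g0 gam0.
Qed.

Section rellich.
Context {R : realType} {M : ptopologicalType} {m : nat} {A : manifold R M m.+1}.
Context {nu : volume_form A} {mu : {measure set (borel M) -> \bar R}}.
Context {N : nat} {X : 'I_N -> vector_field A}.
Context {y : M} {T : set M} {G : M -> R} {Om : set M} {B : cells (A := A) (boundary Om)}.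
Hypothesis hmu : is_volume_measure nu mu.
Hypothesis hA : assumption_Aplus X nu mu y T G.
Hypothesis hy : ~ boundary Om y.
Hypothesis hOm : strongly_admissible X nu mu y T G B.
Context {u : M -> R}.
Hypothesis hu2 : C2 X Om u.
Hypothesis hu1 : C1_upto X Om (closure Om) u.

Let D : set M := Om `\ y.
Let K : set M := closure Om `\ y.
Let intD (f : M -> R) := mu.-integrable (D : set (borel M)) (EFin \o (f : borel M -> R)).
Let DK : D `<=` K. Proof. exact: punctured_subset. Qed.
Let oD : open D. Proof. exact: open_punctured hOm. Qed.
Let mD : measurable (D : set (borel M)). Proof. exact: open_measurable_borel. Qed.
Let G0 x : K x -> 0 < G x. Proof. exact: (fundamental_gt0 hA hOm). Qed.

Let cLu x : D x -> {for x, continuous (sublaplacian X u)}.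
Proof.
move=> [Ox _]; apply: cvg_sum_ord => k.
by have [_ /(_ k)[_ /(_ k)[_]]] := hu2; apply.
Qed.

(** The left-hand integrand is an abstract [F], known through its Young bounds for all [c]: the
    values 2 and -2 yield integrability, the value [lam * del] the inequality. *)
Lemma rellich_weighted (gam lam del p : R) (ell : R -> R) (F : borel M -> \bar R) :
  0 < gam -> 0 < lam -> 0 <= del -> del <= 4 * lam ->
  p = 1 - 2 * lam / gam -> del = 2 * (gam - lam) ->
  (forall x, K x -> is_derive (G x) 1 ell (- (ell (G x) ^+ 2 / (gam * G x)))) ->
  (forall x, K x -> 0 <= ell (G x) <= 1) ->
  measurable_fun (D : set (borel M)) F -> (forall x, D x -> (0 <= F x)%E) ->
  (forall x c, D x -> ((- c * (G x `^ p * (u x * sublaplacian X u x)) -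
    (c / 2) ^+ 2 / gam ^+ 2 * (G x `^ p * (sqgrad X G x / G x ^+ 2) * u x ^+ 2))%:E <= F x)%E) ->
  let kap := (4 * lam - del) * del in
  let H x := gam ^- 2 * (G x `^ p * (sqgrad X G x / G x ^+ 2) * u x ^+ 2) * ell (G x) ^+ 2 in
  let Ga := int_form B (scale_form (fun x => u x ^+ 2 * G x `^ (p - 1)) (grad_form X nu Om G)) in
  let Gb := int_form B (scale_form (fun x => u x ^+ 2 * (G x `^ (p - 1) * ell (G x)))
    (grad_form X nu Om G)) in
  let Gc := int_form B (scale_form (fun x => G x `^ p * u x) (grad_form X nu Om u)) in
  intD H /\
  ((del ^+ 2 / 4 * (\int[mu]_(x in (D : set (borel M))) (G x `^ p * sqgrad X u x))
    + kap / 16 * (\int[mu]_(x in (D : set (borel M))) H x)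
    + kap / (8 * gam) * Gb + kap * (2 * lam) / (8 * gam) * Ga
    + 2 * lam * del / 4 * (p * Ga - 2 * Gc))%:E <= \int[mu]_(x in (D : set (borel M))) F x)%E.
Proof.
move=> gam0 lam0 del0 dellam pE delE dell ell01 mF F0 FC kap H Ga Gb Gc.
have p1 : p < 1 by rewrite pE gtrBl divr_gt0// mulr_gt0.
pose E x := G x `^ p * sqgrad X u x.
pose H0 x := G x `^ p * (sqgrad X G x / G x ^+ 2) * u x ^+ 2.
have iE : intD E := energy_integrable hmu hA hy hOm hu2 hu1 p1.
have iH0 : intD H0 := hardy_integrable hmu hA hy hOm hu2 hu1 p1.
have H00 x : 0 <= H0 x.
  by rewrite /H0 mulr_ge0 ?sqr_ge0// mulr_ge0 ?powR_ge0// divr_ge0 ?sqgrad_ge0 ?sqr_ge0.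
have cell x : K x -> {for G x, continuous ell}.
  by move=> Kx; apply/differentiable_continuous/derivable1_diffP; have [] := dell x Kx.
have cellG x : D x -> {for x, continuous (ell \o G)}.
  move=> Dx; apply: continuous_comp; last exact/cell/DK.
  by have [+ _] := fundamental_C1 hOm; apply.
have iH : intD H.
  apply: (@dominated_integrable_borel _ _ _ _ _ (fun x => gam ^- 2 * H0 x)) => //.
  - apply: measurable_funM.
      apply: measurable_funM; first exact: measurable_cst.
      exact: integrable_measurable_borel iH0.
    apply: measurable_funX; exact: continuous_measurable_borel oD cellG.
  - move=> x Dx; have /andP[e0 e1] := ell01 x (DK Dx).
    have gH : 0 <= gam ^- 2 * H0 x by rewrite mulr_ge0 ?invr_ge0 ?sqr_ge0.
    rewrite ger0_norm; last by rewrite mulr_ge0 ?sqr_ge0.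
    by rewrite ler_piMr// exprn_ile1.
  - exact: integrableZ_borel.
split => //.
(* An infinite left-hand side leaves nothing to prove; a finite one is the source of control on
   [L u]. *)
have [->|Foo] := eqVneq (\int[mu]_(x in (D : set (borel M))) F x)%E +oo%E; first exact: leey.
have iF : mu.-integrable (D : set (borel M)) F.
  apply/integrableP; split => //.
  have -> : (\int[mu]_(x in (D : set (borel M))) `|F x| = \int[mu]_(x in (D : set (borel M))) F x)%E.
    by apply: eq_integral => x; rewrite inE => Dx; rewrite gee0_abs ?F0.
  by rewrite ltey.
pose L x := G x `^ p * (u x * sublaplacian X u x).
have iL : intD L.
  (* [Y] is the remainder in the Young bounds for [c = 2] and [c = -2], which together give
     [2 |L| <= F + Y]. *)
  pose Y x := ((2%:R / 2) ^+ 2 / gam ^+ 2 * H0 x).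
  have iY : intD Y by exact: integrableZ_borel.
  have mL : measurable_fun (D : set (borel M)) (L : borel M -> R).
    apply: (continuous_measurable_borel oD) => x Dx.
    apply: cvgM; first exact: (powR_fundamental_continuous hA hOm).
    by apply: cvgM; [have [[+ _] _] := hu2; apply; case: Dx|exact: cLu].
  apply: (le_integrable mD (f := EFin \o (L : borel M -> R)) _ _ (integrableD mD iF iY)).
    exact/measurable_EFinP.
  move=> x Dx; have Y0 : 0 <= Y x by rewrite mulr_ge0// divr_ge0 ?sqr_ge0.
  rewrite [leRHS]gee0_abs ?adde_ge0 ?lee_fin ?F0// /= -leeBlDr//.
  apply: le_trans (_ : (2 * `|L x| - Y x)%:E <= _)%E.
    by rewrite -EFinB lee_fin lerB// ler_peMl// ler1n.
  have h1 : ((- 2 * L x - Y x)%:E <= F x)%E by exact: FC.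
  have h2 : ((2 * L x - Y x)%:E <= F x)%E.
    have := FC x (- 2) Dx; congr (_%:E <= _)%E; rewrite /Y /H0 /L; field.
    by rewrite !gt_eqF// G0//; exact: DK.
  have [_|_] := ger0P (L x); first exact: h2.
  by rewrite mulrN -mulNr.
have dpow q x : K x -> is_derive (G x) 1 (@powR R ^~ q) (q * G x `^ (q - 1)).
  exact: (powR_derivable hA hOm).
have cpow q x : K x -> {for G x, continuous (@powR R ^~ q)}.
  exact: (powR_continuous hA hOm).
have pw1 x : D x -> G x `^ (p - 1) = G x `^ p / G x by move=> /DK/G0; exact: powR_pred.
have pw2 x : D x -> G x `^ (p - 1 - 1) = G x `^ p / G x ^+ 2.
  by move=> Dx; have Gx := G0 (DK Dx); rewrite powR_pred// pw1// expr2 invfM mulrA.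
have pG x : D x -> 0 <= G x `^ p / G x by move=> /DK/G0/ltW Gx; rewrite divr_ge0 ?powR_ge0.
have pG2 x : 0 <= G x `^ p / G x ^+ 2 by rewrite divr_ge0 ?powR_ge0 ?sqr_ge0.
have wd := @weighted_divergence _ _ _ _ _ _ _ _ _ _ _ _ _ hmu hA hy hOm _ _ hu2 hu1 p1.
have [|||ia ea] := wd (@powR R ^~ (p - 1)) (fun s => (p - 1) * s `^ (p - 1 - 1))
    (1 + `|p - 1|) (dpow (p - 1)).
- by move=> x Kx; apply: cvgM; [exact: cvg_cst|exact: cpow].
- by move=> x Dx; rewrite pw1// ger0_norm ?pG// ler_peMl ?pG// lerDl.
- move=> x Dx; rewrite normrM pw2// (ger0_norm (pG2 x)).
  by apply: ler_wpM2r (pG2 x) _ _ _; rewrite lerDr.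
(* By the Riccati equation the derivative of [s^(p-1) ell(s)] is [s^(p-2)] times a factor that
   [0 <= ell <= 1] keeps bounded. *)
have [||||ib eb] := wd (fun s => s `^ (p - 1) * ell s)
    (fun s => (p - 1) * s `^ (p - 1 - 1) * ell s - s `^ (p - 1) * (ell s ^+ 2 / (gam * s)))
    (1 + (`|p - 1| + gam^-1)).
- move=> x Kx; have d1 := dpow (p - 1) x Kx; have d2 := dell x Kx.
  apply: (is_derive_eq (is_deriveM d1 d2)).
  by rewrite /GRing.scale/= mulrN addrC; congr (_ - _); rewrite mulrC.
- move=> x Kx; have Gx := G0 Kx; apply: cvgB; apply: cvgM.
  + by apply: cvgM; [exact: cvg_cst|exact: cpow].
  + exact: cell.
  + exact: cpow.
  + apply: cvgM.
      apply: (@continuous_comp _ _ _ ell (fun s => s ^+ 2)); first exact: cell.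
      exact: exprn_continuous.
    apply: cvgV; first by rewrite mulf_neq0// gt_eqF.
    by apply: cvgM; [exact: cvg_cst|exact: cvg_id].
- move=> x Dx; have /andP[e0 e1] := ell01 x (DK Dx).
  rewrite pw1// ger0_norm; last by apply: mulr_ge0 => //; exact: pG.
  apply: (@le_trans _ _ (G x `^ p / G x)); first by rewrite ler_piMr ?pG.
  by rewrite ler_peMl ?pG// lerDl addr_ge0// invr_ge0 ltW.
- move=> x Dx; have /andP[e0 e1] := ell01 x (DK Dx); have Gx := G0 (DK Dx).
  rewrite pw1// pw2//.
  rewrite (_ : _ - _ = ((p - 1) * ell (G x) - ell (G x) ^+ 2 / gam) * (G x `^ p / G x ^+ 2)).
    rewrite normrM (ger0_norm (pG2 x)); apply: ler_wpM2r (pG2 x) _ _ _.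
    apply: (le_trans (ler_normB _ _)); apply: le_trans (_ : `|p - 1| + gam^-1 <= _); last first.
      by rewrite lerDr.
    apply: lerD; first by rewrite normrM (ger0_norm e0) ler_piMr.
    rewrite ger0_norm; last by rewrite divr_ge0 ?sqr_ge0// ltW.
    by rewrite ler_piMl ?invr_ge0 ?(ltW gam0)// exprn_ile1.
  by field; rewrite !gt_eqF.
have [ic ec] := flux_divergence hmu hA hy hOm hu2 hu1 p1 iL.
set Ia := (fun x => _) in ia ea; set Ib := (fun x => _) in ib eb.
set Ic := (fun x => _) in ic ec.
have ea' : \int[mu]_(x in (D : set (borel M))) Ia x = Ga := ea.
have eb' : \int[mu]_(x in (D : set (borel M))) Ib x = Gb := eb.
have ec' : \int[mu]_(x in (D : set (borel M))) Ic x = Gc := ec.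
clearbody Ga Gb Gc.
pose r x := del ^+ 2 / 4 * E x + kap / 16 * H x + kap / (8 * gam) * Ib x +
  kap * (2 * lam) / (8 * gam) * Ia x + 2 * lam * del / 4 * p * Ia x +
  - (2 * lam * del / 4 * 2) * Ic x.
have iZ c f : intD f -> intD (fun x => c * f x) by exact: integrableZ_borel.
have iD f g : intD f -> intD g -> intD (fun x => f x + g x) by exact: integrableD_borel.
have eZ c f : intD f -> \int[mu]_(x in (D : set (borel M))) (c * f x) =
  c * \int[mu]_(x in (D : set (borel M))) f x by exact: RintegralZl.
have eD f g : intD f -> intD g -> \int[mu]_(x in (D : set (borel M))) (f x + g x) =
    \int[mu]_(x in (D : set (borel M))) f x + \int[mu]_(x in (D : set (borel M))) g x.
  by move=> fi gi; exact: (RintegralD mD fi gi).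
have i1 := iD _ _ (iZ (del ^+ 2 / 4) _ iE) (iZ (kap / 16) _ iH).
have i2 := iD _ _ i1 (iZ (kap / (8 * gam)) _ ib).
have i3 := iD _ _ i2 (iZ (kap * (2 * lam) / (8 * gam)) _ ia).
have i4 := iD _ _ i3 (iZ (2 * lam * del / 4 * p) _ ia).
have ir : intD r := iD _ _ i4 (iZ (- (2 * lam * del / 4 * 2)) _ ic).
have er : \int[mu]_(x in (D : set (borel M))) r x =
    del ^+ 2 / 4 * (\int[mu]_(x in (D : set (borel M))) E x)
    + kap / 16 * (\int[mu]_(x in (D : set (borel M))) H x)
    + kap / (8 * gam) * Gb + kap * (2 * lam) / (8 * gam) * Ga
    + 2 * lam * del / 4 * (p * Ga - 2 * Gc).
  have e5 := eD _ _ i4 (iZ (- (2 * lam * del / 4 * 2)) _ ic).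
  have e4 := eD _ _ i3 (iZ (2 * lam * del / 4 * p) _ ia).
  have e3 := eD _ _ i2 (iZ (kap * (2 * lam) / (8 * gam)) _ ia).
  have e2 := eD _ _ i1 (iZ (kap / (8 * gam)) _ ib).
  have e1 := eD _ _ (iZ (del ^+ 2 / 4) _ iE) (iZ (kap / 16) _ iH).
  rewrite e5 e4 e3 e2 e1 (eZ _ _ iE) (eZ _ _ iH) (eZ _ _ ib) !(eZ _ _ ia) (eZ _ _ ic) ea' eb' ec'.
  by ring.
rewrite -er /Rintegral fineK; last exact: (integrable_fin_num mD ir).
apply: (le_integral mD ir iF) => x; rewrite inE => Dx.
have Gx := G0 (DK Dx).
(* The choice of [c] is forced: [- lam * del] is the coefficient with which [Ic] brings in
   [w u (L u)]. *)
apply: le_trans (FC x (lam * del) Dx); rewrite lee_fin.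
have gn : G x != 0 by rewrite gt_eqF.
have gamn : gam != 0 by rewrite gt_eqF.
have eIa : Ia x = 2 * u x * (G x `^ p / G x) * (\sum_k Xd (X k) u x * Xd (X k) G x) +
    u x ^+ 2 * ((p - 1) * (G x `^ p / G x ^+ 2)) * sqgrad X G x.
  by rewrite /Ia pw1// pw2.
have eIb : Ib x = 2 * u x * (G x `^ p / G x * ell (G x)) *
      (\sum_k Xd (X k) u x * Xd (X k) G x) + u x ^+ 2 * ((p - 1) * (G x `^ p / G x ^+ 2) *
      ell (G x) - G x `^ p / G x ^+ 2 * ell (G x) ^+ 2 / gam) * sqgrad X G x.
  rewrite /Ib pw1// pw2//; congr (_ + _ * (_ - _) * _).
  by field; rewrite gn gamn.
have -> : r x = del ^+ 2 / 4 * E x + kap / 16 * H x + kap / (8 * gam) * Ib x +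
    kap * (2 * lam) / (8 * gam) * Ia x + 2 * lam * del / 4 * (p * Ia x - 2 * Ic x).
  by rewrite /r; ring.
rewrite eIa eIb; apply: le_trans.
  rewrite le_eqVlt; apply/orP; left; apply/eqP.
  exact: (rellich_identity (fun k => Xd (X k) u x) (fun k => Xd (X k) G x) (G x `^ p)
    (ell (G x)) (u x) (sublaplacian X u x) gn gamn pE delE).
(* What remains is [kap / 4] times a weighted square, with [kap >= 0] by [0 <= del <= 4 * lam]. *)
rewrite lerBlDr lerDl mulr_ge0//; first by rewrite divr_ge0 ?mulr_ge0 ?subr_ge0.
by rewrite mulr_ge0 ?powR_ge0// sumr_ge0// => k _; exact: sqr_ge0.
Qed.

End rellich.

(** For [b = gam^-1] this is the Riccati equation of the logarithmic weight. The inverse is a power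
    -1 so that the rule for real powers differentiates it. *)
Lemma is_derive_inv_log (R : realType) (a b s : R) : 0 < s -> 0 < a + b * ln s ->
  is_derive s 1 (fun t => (a + b * ln t) `^ (-1))
    (- (((a + b * ln s) `^ (-1)) ^+ 2 * (b / s))).
Proof.
move=> s0 l0.
have d1 : is_derive s 1 (fun t => a + b * ln t) (b / s).
  have dl := is_derive1_ln s0.
  apply: (is_derive_eq (is_deriveD (is_derive_cst a s 1) (is_deriveM (is_derive_cst b s 1) dl))).
  by rewrite /GRing.scale/= mulr0 addr0 add0r.
apply: (is_derive_eq (is_derive1_comp (g := fun t => a + b * ln t) (is_derive1_powR (-1) l0) d1)).
by rewrite powR_pred// (powR_inv1 (ltW l0)) mulN1r mulNr expr2.
Qed.

Theorem theorem4p2 (R : realType) (M : ptopologicalType) (m : nat)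
    (A : manifold R M m.+1) (nu : volume_form A)
    (mu : {measure set (borel M) -> \bar R}) (hmu : is_volume_measure nu mu)
    (N : nat) (hN : (N <= m.+1)%N) (X : 'I_N -> vector_field A)
    (y : M) (T : set M) (G : M -> R) (hA : assumption_Aplus X nu mu y T G)
    (Om : set M) (B : cells (A := A) (boundary Om))
    (hy : ~ boundary Om y)
    (hOm : strongly_admissible X nu mu y T G B)
    (alpha beta R0 : R) (hab : alpha < beta) (hba : (8 - beta) / 3 < alpha)
    (hb : 2 < beta)
    (hR0 : expR 1 * sup [set G x `^ (2 - beta)^-1 | x in Om `\ y] <= R0)
    (u : M -> R) (hu2 : C2 X Om u) (hu1 : C1_upto X Om (closure Om) u) :
  let d := fun x => G x `^ (2 - beta)^-1 in
  let p := (alpha - 2) / (2 - beta) in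
  let bdry_u := int_form B
    (scale_form (fun x => G x `^ (p - 1) * u x ^+ 2) (grad_form X nu Om G)) in
  let bdry_ln_u := int_form B
    (scale_form (fun x => G x `^ (p - 1) * (ln (R0 / d x))^-1 * u x ^+ 2)
       (grad_form X nu Om G)) in
  let Cu :=
    p * int_form B
      (scale_form (fun x => u x ^+ 2 * G x `^ (p - 1)) (grad_form X nu Om G))
    - 2 * int_form B
      (scale_form (fun x => G x `^ p * u x) (grad_form X nu Om u)) in
  let lhs := (\int[mu]_(x in Om)
    ((G x `^ (alpha / (2 - beta)) * sublaplacian X u x ^+ 2)%:E
       / (sqgrad X d x)%:E))%E in
  let energy := (\int[mu]_(x in Om) (G x `^ p * sqgrad X u x)%:E)%E in
  let hardy := (\int[mu]_(x in Om)
    (G x `^ ((alpha - 4) / (2 - beta)) * sqgrad X d x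
       * (ln (R0 / d x)) ^- 2 * u x ^+ 2)%:E)%E in
  (((beta - alpha) ^+ 2 / 4)%:E * energy
   + ((beta + 3 * alpha - 8) * (beta + alpha - 4) * (beta - alpha)
        / (8 * (beta - 2)) * bdry_u)%:E
   + ((beta + alpha - 4) * (beta - alpha) / 4 * Cu)%:E <= lhs)%E
  /\
  (((beta - alpha) ^+ 2 / 4)%:E * energy
   + ((beta + 3 * alpha - 8) * (beta - alpha) / 16)%:E * hardy
   + ((beta + 3 * alpha - 8) * (beta - alpha) / (8 * (beta - 2))
        * bdry_ln_u)%:E
   + ((beta + 3 * alpha - 8) * (beta + alpha - 4) * (beta - alpha)
        / (8 * (beta - 2)) * bdry_u)%:E
   + ((beta + alpha - 4) * (beta - alpha) / 4 * Cu)%:E <= lhs)%E.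
Proof.
move=> d p bdry_u bdry_ln_u Cu lhs energy hardy.
pose D : set M := Om `\ y; pose K : set M := closure Om `\ y.
pose gam := beta - 2; pose lam := (beta + alpha - 4) / 2; pose del := beta - alpha.
have gam0 : 0 < gam by rewrite /gam; lra.
have gamn : beta - 2 != 0 by rewrite gt_eqF.
(* Indeed [3 * (beta + alpha - 4) > 2 * (beta - 2) > 0]. *)
have lam0 : 0 < lam by rewrite /lam; lra.
have del0 : 0 <= del by rewrite /del; lra.
(* The difference [4 * lam - del] is [beta + 3 * alpha - 8]. *)
have dellam : del <= 4 * lam by rewrite /del /lam; lra.
have pE : p = 1 - 2 * lam / gam.
  rewrite /p /lam /gam -(opprB beta 2) invrN; by field.
have delE : del = 2 * (gam - lam) by rewrite /del /gam /lam; field.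
have oOm : open Om by case: hOm => -[[]].
have DK : D `<=` K by exact: punctured_subset.
have oD : open D := open_punctured hOm.
have mD : measurable (D : set (borel M)) by exact: open_measurable_borel.
have G0 x : K x -> 0 < G x by exact: (fundamental_gt0 hA hOm).
have d0 x : K x -> 0 < d x by move=> /G0 ?; exact: powR_gt0.
have p1 : p < 1 by rewrite pE gtrBl divr_gt0// mulr_gt0.
have iE := energy_integrable hmu hA hy hOm hu2 hu1 p1.
have mcont (f : M -> R) : (forall x, D x -> {for x, continuous f}) ->
    measurable_fun (D : set (borel M)) (f : borel M -> R).
  exact: continuous_measurable_borel.
(* As [d] is [G] to the power [- 1 / gam], this is the chain rule factor between the squared
   gradients of [d] and [G]. *)
pose b x := gam ^- 2 * (d x / G x) ^+ 2.
have sd x : D x -> sqgrad X d x = b x * sqgrad X G x.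
  move=> Dx; rewrite /sqgrad mulr_sumr; apply: eq_bigr => k _.
  have -> : Xd (X k) d x = (2 - beta)^-1 * G x `^ ((2 - beta)^-1 - 1) * Xd (X k) G x.
    exact: (Xd_powR_fundamental hA hOm).
  rewrite powR_pred ?G0//; last exact: DK.
  rewrite -/(d x) /b -(opprB beta 2) -/gam invrN; field.
  by rewrite !gt_eqF// G0//; exact: DK.
have dE q x : D x -> G x `^ ((q - 2) / (2 - beta)) * d x ^+ 2 = G x `^ (q / (2 - beta)).
  move=> Dx; have Gx := G0 _ (DK _ Dx).
  rewrite /d -powR_mulrn ?powR_ge0// -powRrM -powRD; last by rewrite (gt_eqF Gx) implybT.
  congr (_ `^ _); rewrite -(opprB beta 2) invrN; by field.
pose F x := ((G x `^ (alpha / (2 - beta)) * sublaplacian X u x ^+ 2)%:E / (sqgrad X d x)%:E)%E.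
have cG x : D x -> {for x, continuous G} by have [+ _] := fundamental_C1 hOm; apply.
have cpow q x : D x -> {for x, continuous (fun z => G z `^ q)}.
  exact: (powR_fundamental_continuous hA hOm).
have mS : measurable_fun (D : set (borel M)) (sqgrad X d : borel M -> R).
  apply: (eq_measurable_fun (fun x : borel M => b x * sqgrad X G x)).
    by move=> x; rewrite inE => Dx; rewrite sd.
  apply: mcont => x Dx; apply: cvgM; last exact: (sqgrad_continuous hOm).
  apply: cvgM; first exact: cvg_cst.
  apply: (@continuous_comp _ _ _ (fun x => d x / G x) (fun s => s ^+ 2)); last exact: exprn_continuous.
  apply: cvgM; first exact: cpow.
  by apply: cvgV; [rewrite gt_eqF// G0//; exact: DK|exact: cG].
have mF : measurable_fun (D : set (borel M)) (F : borel M -> \bar R).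
  apply: emeasurable_funM; last first.
    by apply: measurable_fun_inve => // x _; exact: sqgrad_ge0.
  apply/measurable_EFinP; apply: mcont => x Dx; apply: cvgM; first exact: cpow.
  apply: (@continuous_comp _ _ _ (sublaplacian X u) (fun s => s ^+ 2)); last exact: exprn_continuous.
  apply: cvg_sum_ord => k.
  by have [_ /(_ k)[_ /(_ k)[_]]] := hu2; apply; case: Dx.
have F0 x : (0 <= F x)%E.
  by rewrite mule_ge0// ?inve_ge0 lee_fin ?sqgrad_ge0// mulr_ge0 ?powR_ge0 ?sqr_ge0.
have FC x c : D x -> ((- c * (G x `^ p * (u x * sublaplacian X u x)) -
    (c / 2) ^+ 2 / gam ^+ 2 * (G x `^ p * (sqgrad X G x / G x ^+ 2) * u x ^+ 2))%:E <= F x)%E.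
  move=> Dx; have Gx := G0 _ (DK _ Dx); have dx := d0 _ (DK _ Dx).
  rewrite /F sd//; apply: rellich_young; rewrite ?powR_gt0 ?sqgrad_ge0//.
    by rewrite /b mulr_gt0 ?invr_gt0 ?exprn_gt0// divr_gt0.
  by rewrite -(dE alpha x Dx) -/p /b; field; rewrite !gt_eqF.
pose IE := \int[mu]_(x in (D : set (borel M))) (G x `^ p * sqgrad X u x).
pose H (ell : R -> R) x :=
  gam ^- 2 * (G x `^ p * (sqgrad X G x / G x ^+ 2) * u x ^+ 2) * ell (G x) ^+ 2.
pose IH ell := \int[mu]_(x in (D : set (borel M))) H ell x.
pose Ga := int_form B
  (scale_form (fun x => u x ^+ 2 * G x `^ (p - 1)) (grad_form X nu Om G)).
pose Gb (ell : R -> R) := int_form B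
  (scale_form (fun x => u x ^+ 2 * (G x `^ (p - 1) * ell (G x))) (grad_form X nu Om G)).
pose Gc := int_form B (scale_form (fun x => G x `^ p * u x) (grad_form X nu Om u)).
pose kap := (4 * lam - del) * del.
have core (ell : R -> R) :
    (forall x, K x -> is_derive (G x) 1 ell (- (ell (G x) ^+ 2 / (gam * G x)))) ->
    (forall x, K x -> 0 <= ell (G x) <= 1) ->
    mu.-integrable (D : set (borel M)) (EFin \o (H ell : borel M -> R)) /\
    ((del ^+ 2 / 4 * IE + kap / 16 * IH ell + kap / (8 * gam) * Gb ell
      + kap * (2 * lam) / (8 * gam) * Ga + 2 * lam * del / 4 * (p * Ga - 2 * Gc))%:E <=
      \int[mu]_(x in (D : set (borel M))) F x)%E.
  move=> dell ell01.
  exact: (rellich_weighted hmu hA hy hOm hu2 hu1 gam0 lam0 del0 dellam pE delE dell ell01 mF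
    (fun x _ => F0 x) FC).
have lhsE : lhs = (\int[mu]_(x in (D : set (borel M))) F x)%E.
  by rewrite /lhs (ge0_integralD1_borel hmu oOm mF).
have energyE : energy = IE%:E.
  rewrite /IE /Rintegral fineK; last exact: (integrable_fin_num mD iE).
  rewrite /energy (ge0_integralD1_borel hmu (y := y) oOm)//.
    by have /integrableP[] := iE.
  by move=> x _; rewrite lee_fin mulr_ge0 ?powR_ge0 ?sqgrad_ge0.
have bdry_uE : bdry_u = Ga.
  by apply: eq_int_form => x W _; rewrite /scale_form [_ `^ _ * _]mulrC.
have CuE : Cu = p * Ga - 2 * Gc by [].
pose lR x := ln R0 + gam^-1 * ln (G x).
have lRE x : K x -> ln (R0 / d x) = lR x /\ 1 <= lR x.
  move=> Kx; set s := sup _ in hR0.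
  have ds : d x <= s.
    apply: (within_continuous_le (E := D) (K := K)) Kx => //.
    - exact: (powR_fundamental_within hA hOm).
    - by move=> z; exact: (closure_punctured (A := A)).
    (* A value lies below [sup] only if the set is bounded above; the lower bound on [G] ensures it,
       the exponent being negative. *)
    - move=> z Dz; apply: ub_le_sup; last by exists z.
      have [c c0 hc] := fundamental_lbound hA hOm.
      exists (c `^ (2 - beta)^-1) => _ [t Dt <-].
      have Gt := G0 _ (DK _ Dt); have ct := hc _ (DK _ Dt).
      rewrite -(opprB beta 2) invrN !(powRN _ (beta - 2)^-1) lef_pV2 ?posrE ?powR_gt0//.
      by apply: ge0_ler_powR => //; rewrite ?nnegrE ?invr_ge0; exact: ltW.
  have dx := d0 _ Kx; have Gx := G0 _ Kx.
  have eR : expR 1 * d x <= R0 by apply: le_trans hR0; rewrite ler_pM2l ?expR_gt0.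
  have R00 : 0 < R0 by apply: lt_le_trans eR; rewrite mulr_gt0 ?expR_gt0.
  have lnE : ln (R0 / d x) = lR x.
    by rewrite ln_div ?posrE// /d ln_powR /lR -(opprB beta 2) invrN mulNr opprK.
  split => //; rewrite -lnE -[leLHS](expRK 1) ler_ln ?posrE ?expR_gt0 ?divr_gt0//.
  by rewrite ler_pdivlMr.
pose ell (s : R) : R := (ln R0 + gam^-1 * ln s) `^ (-1).
have ellE x : K x -> ell (G x) = (ln (R0 / d x))^-1.
  by move=> /lRE[-> l1]; rewrite /ell powR_inv1// (le_trans ler01).
have kapE : kap = (beta + 3 * alpha - 8) * (beta - alpha).
  by rewrite /kap /lam /del; field.
have lam2 : 2 * lam = beta + alpha - 4 by rewrite /lam; field.
split.
  (* The zero solution of the Riccati equation removes the Hardy term and the logarithmic boundary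
     term. *)
  have [||_] := core (cst 0).
  - move=> x _; apply: (is_derive_eq (is_derive_cst _ _ _)).
    by rewrite expr0n/= mul0r oppr0.
  - by move=> x _; rewrite lexx ler01.
  have -> : IH (cst 0) = 0.
    by rewrite /IH /Rintegral integral0_eq// => x _; rewrite /H expr0n/= mulr0.
  have -> : Gb (cst 0) = 0.
    apply: big1 => j _; rewrite /Rintegral integral0_eq ?mulr0// => t _.
    by rewrite /pullback /scale_form !mulr0 mul0r.
  rewrite -lhsE; apply: le_trans; rewrite energyE -!EFinM -!EFinD lee_fin.
  rewrite CuE bdry_uE kapE lam2 /del /gam; move: (IE) (Ga) (Gc) => a b' c'.
  by rewrite le_eqVlt; apply/orP; left; apply/eqP; ring.
have [||iH] := core ell.
- move=> x Kx; have Gx := G0 _ Kx; have [_ l1] := lRE _ Kx.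
  have l0 : 0 < ln R0 + gam^-1 * ln (G x) by exact: lt_le_trans l1.
  apply: (is_derive_eq (is_derive_inv_log Gx l0)).
  by rewrite -/(ell (G x)) invfM.
- move=> x Kx; have [e l1] := lRE _ Kx; rewrite (ellE _ Kx) e.
  by rewrite invr_ge0 (le_trans ler01 l1) invf_le1// (lt_le_trans ltr01 l1).
rewrite -lhsE; apply: le_trans.
have hardyE : hardy = (IH ell)%:E.
  rewrite /IH /Rintegral fineK; last exact: (integrable_fin_num mD iH).
  have e x : D x -> G x `^ ((alpha - 4) / (2 - beta)) * sqgrad X d x * (ln (R0 / d x)) ^- 2 *
      u x ^+ 2 = H ell x.
    move=> Dx; rewrite /H sd// /p -(dE (alpha - 2) x Dx) /b (ellE _ (DK _ Dx)) exprVn.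
    have -> : alpha - 2 - 2 = alpha - 4 by ring.
    have [_ l1] := lRE _ (DK _ Dx); have [-> _] := lRE _ (DK _ Dx).
    have ln0 : lR x != 0 by rewrite gt_eqF// (lt_le_trans ltr01).
    move: (lR x) ln0 => l ln0; field; rewrite ln0/= !gt_eqF// G0//; exact: DK.
  rewrite /hardy (ge0_integralD1_borel hmu (y := y) oOm).
  - by apply: eq_integral => x; rewrite inE => Dx; rewrite e.
  - have /integrableP[mH _] := iH; apply: eq_measurable_fun mH => x; rewrite inE => Dx.
    by rewrite /= e.
  - move=> x _; rewrite lee_fin mulr_ge0 ?sqr_ge0// mulr_ge0 ?invr_ge0 ?sqr_ge0//.
    by rewrite mulr_ge0 ?powR_ge0 ?sqgrad_ge0.
have bdry_lnE : bdry_ln_u = Gb ell.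
  apply: eq_int_form => x W bx; rewrite /scale_form ellE; first by congr (_ * _); ring.
  (* Boundary points differ from [y], so they lie in [K], where [ellE] is available. *)
  by split; [case: bx|move=> xy; apply: hy; rewrite -xy].
rewrite energyE hardyE -!EFinM -!EFinD lee_fin.
rewrite CuE bdry_uE bdry_lnE kapE lam2 /del /gam; move: (IE) (IH ell) (Ga) (Gb ell) (Gc) => *.
by rewrite le_eqVlt; apply/orP; left; apply/eqP; ring.
Qed.
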